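(* Let $R=\mathbb{C}[x,y]$. For any non zero reduced (i.e. square-free) polynomial $f\in R$, the complexes of $\mathbb{C}$-vector spaces $\Omega^\bullet(\log f)$ (the logarithmic de Rham complex of $f$) and $DR(\widetilde{M}^{\log f})$ (the de Rham complex of the left $A_2$-module $\widetilde{M}^{\log f}$) are naturally quasi-isomorphic.
   Context: Notation: $R=\mathbb{C}[x,y]=\mathbb{C}[x_1,x_2]$; $A_2=\mathbb{C}\langle x_1,x_2,\partial_1,\partial_2\rangle$ is the Weyl algebra of order $2$ over $\mathbb{C}$, where $\partial_i=\partial/\partial x_i$; $(\Omega_R^\bullet,d)$ is the complex of polynomial differential forms with exterior derivative $d$; $R_f=\{g/f^m \mid g\in R,\ m\in\mathbb{N}\}$; and $(\Omega_f^\bullet,d)=(R_f\otimes_R\Omega_R^\bullet,d)$ is the complex of rational differential forms with coefficients in $R_f$. Logarithmic forms: a form $\omega\in\Omega_f^p$ is logarithmic with respect to $f$ if $f\omega\in\Omega_R^p$ and $f\,d\omega\in\Omega_R^{p+1}$. The $R$-module of logarithmic $p$-forms is denoted $\Omega^p(\log f)$, and $\Omega^\bullet(\log f)$ is the complex $0\to\Omega^0(\log f)\xrightarrow{d}\Omega^1(\log f)\xrightarrow{d}\Omega^2(\log f)\to 0$. Logarithmic vector fields: $Der_R(-\log f)=\{\delta=a_1\partial_1+a_2\partial_2 \mid a_1,a_2\in R,\ \delta(f)\in R\cdot f\}$. The module $\widetilde{M}^{\log f}$: put $\widetilde{Der}_R(-\log f)=\{\delta+\frac{\delta(f)}{f}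 \mid \delta\in Der_R(-\log f)\}\subset A_2$, and let $\widetilde{M}^{\log f}=A_2/\bigl(A_2\,\widetilde{Der}_R(-\log f)\bigr)$, the quotient of $A_2$ by the left ideal generated by this set. De Rham complex: for a left $A_2$-module $M$, $DR(M)$ is the complex of $\mathbb{C}$-vector spaces $(M\otimes_R\Omega_R^\bullet,\nabla^\bullet)$ with $\nabla^0(m)=\sum_i\partial_i(m)\otimes dx_i$ and, for $p\ge 1$, $\nabla^p(m\otimes\omega)=\nabla^0(m)\wedge\omega+m\otimes d\omega$, with $M\otimes_R\Omega^0_R=M$ placed in degree $0$. *)

(* Defs.v *)
From HB Require Import structures.
From mathcomp Require Import all_boot all_order all_algebra.
From mathcomp Require Import generic_quotient ring_quotient fraction ring.
From mathcomp Require Import complex mpoly boolp functions reals.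

Set Implicit Arguments.
Unset Strict Implicit.
Unset Printing Implicit Defensive.

Import GRing.Theory Num.Theory.
Import Quotient.

Local Open Scope ring_scope.
Local Open Scope quotient_scope.

Section SubModule.
Variables (A : nzRingType) (V : lmodType A) (S : submodClosed V).

Record submodule := Submodule {
  submodule_val :> V;
  submodule_valP : submodule_val \in (S : {pred V}) }.

HB.instance Definition _ := [isSub for submodule_val].
HB.instance Definition _ := [Choice of submodule by <:].
HB.instance Definition _ := [SubChoice_isSubLmodule of submodule by <:].

End SubModule.

Section QuotientModule.
Variables (A : nzRingType) (V : lmodType A) (S : submodClosed V).

Definition submod_pred : {pred V} := fun v => v \in S.

Lemma submod_pred_closed : zmod_closed submod_pred.
Proof.
by split=> [|u v uS vS]; rewrite unfold_in ?rpred0 // rpredD // -scaleN1r rpredZ.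
Qed.

HB.instance Definition _ :=
  GRing.isZmodClosed.Build V submod_pred submod_pred_closed.

Definition quotmod : Type := {quot submod_pred}.

HB.instance Definition _ := GRing.Zmodule.on quotmod.

Definition quotpi (v : V) : quotmod := \pi_({quot submod_pred}) v.

Lemma quotpiP v w : reflect (quotpi v = quotpi w) (v - w \in S).
Proof.
rewrite -[_ \in S]/(v - w \in submod_pred) idealrBE; exact: eqP.
Qed.

Lemma quotpiD v w : quotpi (v + w) = quotpi v + quotpi w.
Proof. by rewrite /quotpi [LHS]pi_addr. Qed.

Lemma quotpi_surj (x : quotmod) : exists v, x = quotpi v.
Proof. by exists (repr (x : {quot submod_pred})); rewrite /quotpi reprK. Qed.

Definition quotscale (a : A) (x : quotmod) : quotmod :=
  quotpi (a *: repr (x : {quot submod_pred})).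

Lemma quotscaleE a v : quotscale a (quotpi v) = quotpi (a *: v).
Proof.
apply/quotpiP; rewrite -scalerBr rpredZ //.
by apply/quotpiP; rewrite /quotpi reprK.
Qed.

Lemma quotscaleA a b x : quotscale a (quotscale b x) = quotscale (a * b) x.
Proof. by have [v ->] := quotpi_surj x; rewrite !quotscaleE scalerA. Qed.

Lemma quotscale1 : left_id 1 quotscale.
Proof.
by move=> x; have [v ->] := quotpi_surj x; rewrite !quotscaleE scale1r.
Qed.

Lemma quotscaleDr : right_distributive quotscale +%R.
Proof.
move=> a x y; have [v ->] := quotpi_surj x; have [w ->] := quotpi_surj y.
by rewrite -quotpiD !quotscaleE scalerDr quotpiD.
Qed.

Lemma quotscaleDl x : {morph quotscale^~ x : a b / a + b}.
Proof.
move=> a b; have [v ->] := quotpi_surj x.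
by rewrite !quotscaleE scalerDl quotpiD.
Qed.

HB.instance Definition _ := GRing.Zmodule_isLmodule.Build A quotmod
  quotscaleA quotscale1 quotscaleDr quotscaleDl.

Lemma quotpi_is_linear : linear quotpi.
Proof. by move=> a v w; rewrite quotpiD -quotscaleE. Qed.

HB.instance Definition _ :=
  GRing.isLinear.Build A V quotmod _ quotpi quotpi_is_linear.

End QuotientModule.

Section Cochain.
Variable k : fieldType.

Record cochain := Cochain {
  cochain_obj :> nat -> lmodType k;
  cdiff : forall p, {linear cochain_obj p -> cochain_obj p.+1};
  diffK : forall p x, cdiff p.+1 (cdiff p x) = 0 }.

Record cochain_hom (X Y : cochain) := CochainHom {
  cochain_map :> forall p, {linear X p -> Y p};
  cochain_mapd : forall p x,
    cochain_map p.+1 (cdiff X p x) = cdiff Y p (cochain_map p x) }.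

Section Cohomology.
Variables (X : cochain) (p : nat).

Definition cocycle : {pred X p} := fun x => cdiff X p x == 0.

Lemma cocycle_submod : subsemimod_closed cocycle.
Proof.
split; first split.
- by rewrite unfold_in linear0.
- by move=> x y; rewrite !unfold_in linearD => /eqP -> /eqP ->; rewrite addr0.
- by move=> a x; rewrite !unfold_in linearZZ => /eqP ->; rewrite scaler0.
Qed.

HB.instance Definition _ :=
  GRing.isSubmodClosed.Build k (X p) cocycle cocycle_submod.

Definition cocycles : lmodType k := submodule cocycle.

End Cohomology.

Definition is_coboundary (X : cochain) (p : nat) : X p -> Prop :=
  match p with
  | 0 => fun x => x = 0
  | q.+1 => fun x => exists y, x = cdiff X q y
  end.

Definition coboundary (X : cochain) (p : nat) : {pred cocycles X p} :=
  fun z => `[< is_coboundary (val z) >].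

Lemma coboundary_submod X p : subsemimod_closed (@coboundary X p).
Proof.
split; first split; rewrite ?unfold_in.
- by apply/asboolP; case: p => [|p] //=; exists 0; rewrite !linear0.
- move=> x y; rewrite !unfold_in => /asboolP hx /asboolP hy; apply/asboolP.
  rewrite linearD; case: p x y hx hy => [|p] x y /=.
    by move=> -> ->; rewrite addr0.
  by move=> [u ->] [v ->]; exists (u + v); rewrite linearD.
- move=> a x; rewrite !unfold_in => /asboolP hx; apply/asboolP.
  rewrite linearZZ; case: p x hx => [|p] x /=; first by move=> ->; rewrite scaler0.
  by move=> [u ->]; exists (a *: u); rewrite linearZZ.
Qed.

HB.instance Definition _ X p := GRing.isSubmodClosed.Build k (cocycles X p)
  (@coboundary X p) (coboundary_submod X p).

Definition cohomology (X : cochain) (p : nat) : lmodType k :=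
  quotmod (@coboundary X p).

Section Induced.
Variables (X Y : cochain) (phi : cochain_hom X Y) (p : nat).

Lemma cocycle_map (z : cocycles X p) : phi p (val z) \in @cocycle Y p.
Proof.
rewrite unfold_in -cochain_mapd.
by have /eqP -> : cdiff X p (val z) == 0 := valP z; rewrite linear0.
Qed.

Definition cocycles_map (z : cocycles X p) : cocycles Y p :=
  Submodule (cocycle_map z).

(* The class of z is sent to the class of phi z: see cohomology_mapE. *)
Definition cohomology_map (c : cohomology X p) : cohomology Y p :=
  quotpi _ (cocycles_map (repr (c : {quot (submod_pred (@coboundary X p))}))).

Lemma cohomology_mapE z :
  cohomology_map (quotpi _ z) = quotpi _ (cocycles_map z).
Proof.
rewrite /cohomology_map; set z' := repr _.
have /quotpiP : quotpi (@coboundary X p) z' = quotpi _ z.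
  by rewrite /quotpi /z' reprK.
rewrite unfold_in => /asboolP h; apply/quotpiP; rewrite unfold_in; apply/asboolP.
have {h} : is_coboundary (val z' - val z) by rewrite -linearB.
rewrite linearB /= -linearB; move: (val z' - val z) => {z z'} u.
case: p u => [|q] u /=; first by move=> ->; rewrite linear0.
by move=> [y ->]; exists (phi q y); rewrite cochain_mapd.
Qed.

End Induced.

Definition quasi_isomorphism X Y (phi : cochain_hom X Y) : Prop :=
  forall p, bijective (@cohomology_map X Y phi p).

Section SubComplex.
Variables (X : cochain) (S : forall p, submodClosed (X p)).
Hypothesis dS : forall p x, x \in S p -> cdiff X p x \in S p.+1.

Definition subdiff p (x : submodule (S p)) : submodule (S p.+1) :=
  Submodule (dS (submodule_valP x)).

Lemma subdiff_is_linear p : linear (@subdiff p).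
Proof. by move=> a x y; apply: val_inj; rewrite /= !linearP. Qed.

HB.instance Definition _ p :=
  GRing.isLinear.Build k _ _ _ (@subdiff p) (@subdiff_is_linear p).

Lemma subdiffK p x : @subdiff p.+1 (@subdiff p x) = 0.
Proof. by apply: val_inj; rewrite /= diffK. Qed.

Definition subcomplex : cochain :=
  @Cochain (fun p => submodule (S p)) (fun p => @subdiff p) subdiffK.

End SubComplex.

End Cochain.

(* Let R = k[x_1,x_2] and let D give the action of d/dx_1, d/dx_2 on V. An    *)
(* element of dRform V p stands for one of V (x)_R Omega^p_R, written in the  *)
(* basis of the free R-module Omega^p_R formed by 1 (p = 0), dx_1, dx_2       *)
(* (p = 1) and dx_1 /\ dx_2 (p = 2): (a, b) is a (x) dx_1 + b (x) dx_2.       *)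
Section Forms.
Variable k : fieldType.

Definition dRform (V : lmodType k) (p : nat) : lmodType k :=
  match p with
  | 0 => V
  | 1 => (V * V)%type
  | 2 => V
  | _ => 'rV[k]_0
  end.

Definition form_map (V W : lmodType k) (g : V -> W) (p : nat) :
    dRform V p -> dRform W p :=
  match p with
  | 0 => g
  | 1 => fun w => (g w.1, g w.2)
  | 2 => g
  | _ => fun _ => 0
  end.

Definition form_all (V : lmodType k) (P : V -> Prop) (p : nat) :
    dRform V p -> Prop :=
  match p with
  | 0 => P
  | 1 => fun w => P w.1 /\ P w.2
  | 2 => P
  | _ => fun _ => True
  end.

Definition ix : 'I_2 := ord0.
Definition iy : 'I_2 := ord_max.

Section Differential.
Variables (V : lmodType k) (D : 'I_2 -> {linear V -> V}).

Definition dform (p : nat) : dRform V p -> dRform V p.+1 :=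
  match p with
  | 0 => fun m => (D ix m, D iy m)
  | 1 => fun w => D ix w.2 - D iy w.1
  | _ => fun _ => 0
  end.

Lemma dform_is_linear p : linear (@dform p).
Proof.
case: p => [|[|[|p]]] a x y /=.
- by rewrite !linearP.
- rewrite -[LHS]/(D ix (a *: x.2 + y.2) - D iy (a *: x.1 + y.1)).
  by rewrite !linearP /= scalerBr scalerN addrACA.
- by rewrite scaler0 addr0.
- by rewrite scaler0 addr0.
Qed.

HB.instance Definition _ p :=
  GRing.isLinear.Build k _ _ _ (@dform p) (@dform_is_linear p).

Hypothesis Dcomm : forall i j x, D i (D j x) = D j (D i x).

Lemma dformK p x : @dform p.+1 (@dform p x) = 0.
Proof. by case: p x => [|[|p]] x //=; rewrite Dcomm subrr. Qed.

Definition form_complex : cochain k :=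
  @Cochain k (dRform V) (fun p => @dform p) dformK.

End Differential.

Lemma form_map_linear (V W : lmodType k) (g : {linear V -> W}) p :
  linear (@form_map V W g p).
Proof.
case: p => [|[|[|p]]] a x y /=; rewrite ?linearP //.
by rewrite scaler0 addr0.
Qed.

Lemma form_map_dform (V W : lmodType k) (D : 'I_2 -> {linear V -> V})
    (E : 'I_2 -> {linear W -> W}) (g : {linear V -> W}) p x :
  (forall i v, g (D i v) = E i (g v)) ->
  form_map g (dform D x) = dform E (form_map g x) :> dRform W p.+1.
Proof.
by move=> gD; case: p x => [|[|p]] x /=; rewrite ?linearB ?gD.
Qed.

Lemma form_all_dform (V : lmodType k) (D : 'I_2 -> {linear V -> V})
    (P : submodClosed V) p (x : dRform V p) :
  (forall i v, v \in P -> D i v \in P) ->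
  form_all (fun v => v \in P) x -> form_all (fun v => v \in P) (dform D x).
Proof.
move=> PD; case: p x => [|[|p]] x //=; first by move=> Px; split; exact: PD.
- by move=> [Px1 Px2]; rewrite rpredD -?scaleN1r ?rpredZ ?PD.
Qed.

End Forms.

Lemma fraction_repr (A : idomainType) (q : {fraction A}) :
  q * tofrac \d_(repr q) = tofrac \n_(repr q).
Proof.
rewrite -[q in LHS]reprK; set r := repr q; unlock tofrac.
rewrite -[LHS]FracField.pi_mul; apply/eqmodP.
rewrite /= FracField.equivfE /FracField.mulf.
have r0 : \d_r != 0 by exact: denom_ratioP.
by rewrite !numden_Ratio ?mulf_neq0 ?oner_neq0 // !mulr1 /r reprK mulrC.
Qed.

Section RationalForms.
Variable k : fieldType.
Notation R := {mpoly k[2]}.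

Definition ratfun : Type := {fraction R}.

HB.instance Definition _ := GRing.Field.on ratfun.

Definition inj_frac (r : R) : ratfun := tofrac r.

Lemma inj_frac_zmod : zmod_morphism inj_frac.
Proof. exact: rmorphB. Qed.
Lemma inj_frac_monoid : monoid_morphism inj_frac.
Proof. by split; [exact: rmorph1 | exact: rmorphM]. Qed.
HB.instance Definition _ :=
  GRing.isZmodMorphism.Build R ratfun inj_frac inj_frac_zmod.
HB.instance Definition _ :=
  GRing.isMonoidMorphism.Build R ratfun inj_frac inj_frac_monoid.

Lemma inj_frac_eq0 r : (inj_frac r == 0) = (r == 0).
Proof. exact: tofrac_eq0. Qed.

Definition ratscale (c : k) (q : ratfun) : ratfun := inj_frac c%:MP * q.

Lemma ratscaleA a b q : ratscale a (ratscale b q) = ratscale (a * b) q.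
Proof. by rewrite /ratscale mulrA -rmorphM -rmorphM. Qed.
Lemma ratscale1 : left_id 1 ratscale.
Proof. by move=> q; rewrite /ratscale !rmorph1 mul1r. Qed.
Lemma ratscaleDr : right_distributive ratscale +%R.
Proof. by move=> a q r; rewrite /ratscale mulrDr. Qed.
Lemma ratscaleDl q : {morph ratscale^~ q : a b / a + b}.
Proof. by move=> a b; rewrite /ratscale !rmorphD mulrDl. Qed.

HB.instance Definition _ := GRing.Zmodule_isLmodule.Build k ratfun
  ratscaleA ratscale1 ratscaleDr ratscaleDl.

Lemma ratscaleE c (q : ratfun) : c *: q = inj_frac c%:MP * q.
Proof. by []. Qed.

Lemma inj_frac_is_linear : linear inj_frac.
Proof. by move=> c p q; rewrite ratscaleE rmorphD -mul_mpolyC rmorphM. Qed.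
HB.instance Definition _ :=
  GRing.isLinear.Build k R ratfun _ inj_frac inj_frac_is_linear.

(* The quotient rule, on the representative n / d of q chosen by repr; the    *)
(* result does not depend on the representative, see ratderivE.               *)
Definition ratderiv (i : 'I_2) (q : ratfun) : ratfun :=
  let n := \n_(repr (q : {fraction R})) in
  let d := \d_(repr (q : {fraction R})) in
  inj_frac (mderiv i n * d - n * mderiv i d) / inj_frac (d ^+ 2).

Lemma ratfunP (q : ratfun) :
  q = inj_frac \n_(repr (q : {fraction R})) / inj_frac \d_(repr (q : {fraction R})).
Proof.
set n := \n_ _; set d := \d_ _.
have d0 : d != 0 by exact: denom_ratioP.
apply: (canRL (mulfK _)); first by rewrite inj_frac_eq0.
exact: fraction_repr.
Qed.

Lemma ratderivE i a b : b != 0 ->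
  ratderiv i (inj_frac a / inj_frac b) =
  inj_frac (mderiv i a * b - a * mderiv i b) / inj_frac (b ^+ 2).
Proof.
move=> b0; rewrite /ratderiv; set q := inj_frac a / _.
have := ratfunP q; set n := \n_ _; set d := \d_ _.
have d0 : d != 0 by exact: denom_ratioP.
move=> /eqP; rewrite /q eqr_div ?inj_frac_eq0 // -!rmorphM.
move=> /eqP/eqP; rewrite tofrac_eq => /eqP e.
apply/eqP; rewrite eqr_div ?inj_frac_eq0 ?expf_neq0 //; apply/eqP.
rewrite -!rmorphM; congr inj_frac.
have := congr1 (mderiv i) e; rewrite !mderivM => e'.
have {e'} e' : mderiv i n * b - a * mderiv i d = mderiv i a * d - n * mderiv i b.
  by apply/eqP; rewrite subr_eq addrAC eq_sym subr_eq e'.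
transitivity ((mderiv i n * b - a * mderiv i d) * (b * d)
  + (a * d - n * b) * mderiv i d * b).
  by ring.
by rewrite e' e; ring: e.
Qed.

Lemma ratderiv_frac i r : ratderiv i (inj_frac r) = inj_frac (mderiv i r).
Proof.
have := ratderivE i r (oner_neq0 R).
by rewrite -mpolyC1 mderivC mpolyC1 expr1n !rmorph1 !divr1 mulr1 mulr0 subr0.
Qed.

Lemma ratfunW (P : ratfun -> Prop) :
  (forall a b, b != 0 -> P (inj_frac a / inj_frac b)) -> forall q, P q.
Proof. by move=> PP q; rewrite (ratfunP q); apply: PP; exact: denom_ratioP. Qed.

Lemma ratderiv_is_linear i : linear (ratderiv i).
Proof.
move=> c q r; elim/ratfunW: q => a b b0; elim/ratfunW: r => a' b' b0'.
have F0 := (inj_frac_eq0, b0, b0', mulf_neq0, expf_neq0).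
have -> : c *: (inj_frac a / inj_frac b : ratfun) + inj_frac a' / inj_frac b'
  = inj_frac (c%:MP * a * b' + a' * b) / inj_frac (b * b').
  by rewrite ratscaleE mulrA -rmorphM addf_div ?F0 // -!rmorphM -rmorphD.
rewrite !ratderivE ?F0 // ratscaleE mulrA -rmorphM addf_div ?F0 //.
rewrite -!rmorphM -rmorphD; apply/eqP; rewrite eqr_div ?F0 //.
rewrite -!rmorphM; apply/eqP; congr inj_frac.
rewrite !(mderivM, mderivD) mderivC; ring.
Qed.

HB.instance Definition _ i := GRing.isLinear.Build k ratfun ratfun _
  (ratderiv i) (ratderiv_is_linear i).

Lemma ratderiv_comm i j q :
  ratderiv i (ratderiv j q) = ratderiv j (ratderiv i q).
Proof.
elim/ratfunW: q => a b b0; rewrite !ratderivE ?expf_neq0 //.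
congr (inj_frac _ / _).
rewrite !(mderivM, mderivB, expr2) (mderiv_comm j i a) (mderiv_comm j i b).
ring.
Qed.

Definition poly_form (p : nat) (w : dRform ratfun p) : Prop :=
  exists eta : dRform R p, form_map inj_frac eta = w.

Lemma poly_form_dform p (w : dRform ratfun p) :
  poly_form w -> poly_form (dform ratderiv w).
Proof.
move=> [eta <-]; exists (dform (@mderiv 2 k) eta).
apply: form_map_dform => i v; exact/esym/ratderiv_frac.
Qed.

Variable f : R.

Definition in_loc (h : ratfun) : Prop :=
  exists g m, h = inj_frac g / inj_frac f ^+ m.

Definition mul_by_f (h : ratfun) : ratfun := inj_frac f * h.

Lemma mulf_is_linear : linear mul_by_f.
Proof. by move=> a g h; rewrite /mul_by_f mulrDr !ratscaleE mulrCA. Qed.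

HB.instance Definition _ :=
  GRing.isLinear.Build k ratfun ratfun _ mul_by_f mulf_is_linear.

Definition mulf_form (p : nat) (w : dRform ratfun p) : dRform ratfun p :=
  form_map mul_by_f w.

Definition logarithmic (p : nat) (w : dRform ratfun p) : Prop :=
  [/\ form_all in_loc w, poly_form (mulf_form w)
    & poly_form (mulf_form (dform ratderiv w))].

Definition log_form (p : nat) : {pred dRform ratfun p} :=
  fun w => `[< logarithmic w >].

Lemma in_loc_submod a h h' : in_loc h -> in_loc h' -> in_loc (a *: h + h').
Proof.
move=> [g [m ->]] [g' [m' ->]].
have [-> | f0] := eqVneq f 0.
  rewrite rmorph0 !expr0n; case: m => [|m]; case: m' => [|m'] /=;
    rewrite ?invr0 ?mulr0 ?divr1 ?scaler0 ?addr0 ?add0r -?linearZZ -?linearD.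
  - by exists (a *: g + g'), 0%N; rewrite expr0 divr1.
  - by exists (a *: g), 0%N; rewrite expr0 divr1.
  - by exists g', 0%N; rewrite expr0 divr1.
  - by exists 0, 0%N; rewrite rmorph0 mul0r.
have F0 n : inj_frac f ^+ n != 0 by rewrite expf_neq0 ?inj_frac_eq0.
exists (a *: g * f ^+ m' + g' * f ^+ m), (m + m')%N.
rewrite ratscaleE mulrA -rmorphM mul_mpolyC addf_div ?F0 // exprD.
by rewrite rmorphD !rmorphM !rmorphXn.
Qed.

Lemma in_loc_ratderiv i h : in_loc h -> in_loc (ratderiv i h).
Proof.
move=> [g [m ->]]; have [-> | f0] := eqVneq f 0.
  rewrite rmorph0 !expr0n; case: m => [|m] /=.
    by exists (mderiv i g), 0%N; rewrite expr0 !divr1 ratderiv_frac.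
  by exists 0, 0%N; rewrite invr0 mulr0 linear0 rmorph0 mul0r.
rewrite -rmorphXn ratderivE ?expf_neq0 //.
exists (mderiv i g * f ^+ m - g * mderiv i (f ^+ m)), (m * 2)%N.
by rewrite -exprM rmorphXn.
Qed.

Lemma log_form_submod p : subsemimod_closed (@log_form p).
Proof.
have F0 q : mulf_form (0 : dRform ratfun q) = 0.
  by rewrite /mulf_form; case: q => [|[|[|q]]] //=; rewrite linear0.
have Fl q a (x y : dRform ratfun q) :
    mulf_form (a *: x + y) = a *: mulf_form x + mulf_form y.
  exact: (form_map_linear mul_by_f).
have Pl q a (x y : dRform ratfun q) :
    poly_form x -> poly_form y -> poly_form (a *: x + y).
  move=> [u <-] [v <-]; exists (a *: u + v); exact: form_map_linear.
have L0 : logarithmic (0 : dRform ratfun p).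
  split.
  - have l0 : in_loc 0 by exists 0, 0%N; rewrite rmorph0 mul0r.
    by case: p => [|[|[|p]]] //=.
  - by exists 0; rewrite F0; case: p => [|[|[|p]]] //=; rewrite linear0.
  - exists 0; rewrite linear0 F0.
    by case: p => [|[|p]] //=; rewrite linear0.
have Ll a (x y : dRform ratfun p) :
    logarithmic x -> logarithmic y -> logarithmic (a *: x + y).
  move=> [x1 x2 x3] [y1 y2 y3]; split.
  - case: p x y x1 y1 {x2 x3 y2 y3 L0} => [|[|[|p]]] x y //=;
      [exact: in_loc_submod | | exact: in_loc_submod].
    by move=> [? ?] [? ?]; split; exact: in_loc_submod.
  - by rewrite Fl; exact: Pl.
  - by rewrite linearP Fl; exact: Pl.
split; first split; rewrite ?unfold_in.
- by apply/asboolP.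
- move=> x y; rewrite !unfold_in => /asboolP hx /asboolP hy; apply/asboolP.
  by rewrite -[x]scale1r; exact: Ll.
- move=> a x; rewrite !unfold_in => /asboolP hx; apply/asboolP.
  by rewrite -[_ *: _]addr0; exact: Ll.
Qed.

HB.instance Definition _ p := GRing.isSubmodClosed.Build k (dRform ratfun p)
  (@log_form p) (@log_form_submod p).

Lemma log_form_dform p (w : dRform ratfun p) :
  w \in @log_form p -> dform ratderiv w \in @log_form p.+1.
Proof.
rewrite !unfold_in => /asboolP [w1 w2 w3]; apply/asboolP; split=> //.
  case: p w w1 {w2 w3} => [|[|p]] w //=.
    by move=> hw; split; exact: in_loc_ratderiv.
  move=> [h1 h2]; rewrite addrC -scaleN1r.
  by apply: in_loc_submod; exact: in_loc_ratderiv.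
rewrite dformK; last exact: ratderiv_comm.
by exists 0; rewrite /mulf_form; case: p {w w1 w2 w3} => [|p] //=;
  rewrite !linear0.
Qed.

Definition rat_complex : cochain k := form_complex ratderiv_comm.

Definition log_complex : cochain k :=
  @subcomplex k rat_complex (fun p => @log_form p) log_form_dform.

Definition log_val (p : nat) (w : log_complex p) : dRform ratfun p :=
  submodule_val w.

End RationalForms.

Section Weyl.
Variable k : fieldType.
Notation R := {mpoly k[2]}.

(* The operators on k[x_1,x_2] generated by the constants, the x_i and the    *)
(* d/dx_i: in characteristic 0 (and only then) this is the Weyl algebra A_2.  *)
Inductive is_diffop : (R -> R) -> Prop :=
| DiffopC c : is_diffop (fun p => c *: p)
| DiffopX i : is_diffop (fun p => 'X_i * p)
| DiffopD i : is_diffop (fun p => mderiv i p)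
| DiffopAdd P Q : is_diffop P -> is_diffop Q -> is_diffop (fun p => P p + Q p)
| DiffopComp P Q : is_diffop P -> is_diffop Q -> is_diffop (fun p => P (Q p)).

Definition diffop : {pred R -> R} := fun P => `[< is_diffop P >].

Lemma is_diffop_linear P : is_diffop P -> linear P.
Proof.
elim=> [c|i|i|{}P Q _ lP _ lQ|{}P Q _ lP _ lQ] a x y.
- by rewrite scalerDr !scalerA mulrC.
- by rewrite mulrDr scalerAr.
- by rewrite linearP.
- by rewrite lP lQ scalerDr addrACA.
- by rewrite lQ lP.
Qed.

Lemma diffop_zmod : zmod_closed diffop.
Proof.
split=> [|P Q]; rewrite !unfold_in.
  apply/asboolP; rewrite (_ : 0 = (fun p => 0 *: p)); first exact: DiffopC.
  by apply/funext => p; rewrite scale0r.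
move=> /asboolP hP /asboolP hQ; apply/asboolP.
rewrite (_ : P - Q = (fun p => P p + (-1) *: Q p)).
  exact: (DiffopAdd hP (DiffopComp (DiffopC (-1)) hQ)).
by apply/funext => p; rewrite scaleN1r.
Qed.

HB.instance Definition _ := GRing.isZmodClosed.Build (R -> R) diffop diffop_zmod.

Record weyl := Weyl { weyl_op :> R -> R; weyl_opP : weyl_op \in diffop }.

HB.instance Definition _ := [isSub for weyl_op].
HB.instance Definition _ := [Choice of weyl by <:].
HB.instance Definition _ := [SubChoice_isSubZmodule of weyl by <:].

Lemma weylE (P Q : weyl) : P =1 Q -> P = Q.
Proof. by move=> PQ; apply: val_inj; apply/funext. Qed.

Lemma weyl_diffop (P : weyl) : is_diffop P.
Proof. by case: P => P /= /asboolP. Qed.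

Definition mkweyl (P : R -> R) (h : is_diffop P) : weyl :=
  Weyl (introT (asboolP _) h).

Definition opC (c : k) : weyl := mkweyl (DiffopC c).
Definition opD (i : 'I_2) : weyl := mkweyl (DiffopD i).

Definition weyl_mul (P Q : weyl) : weyl :=
  mkweyl (DiffopComp (weyl_diffop P) (weyl_diffop Q)).

Lemma weyl_mulA : associative weyl_mul.
Proof. by move=> P Q S; apply: weylE. Qed.
Lemma weyl_mul1 : left_id (opC 1) weyl_mul.
Proof. by move=> P; apply: weylE => p /=; rewrite scale1r. Qed.
Lemma weyl_mulr1 : right_id (opC 1) weyl_mul.
Proof. by move=> P; apply: weylE => p /=; rewrite scale1r. Qed.
Lemma weyl_mulDl : left_distributive weyl_mul +%R.
Proof. by move=> P Q S; apply: weylE. Qed.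
Lemma weyl_mulDr : right_distributive weyl_mul +%R.
Proof.
move=> P Q S; apply: weylE => p /=.
have lP := is_diffop_linear (weyl_diffop P).
by have := lP 1 (Q p) (S p); rewrite !scale1r.
Qed.
Lemma weyl1_neq0 : opC 1 != 0.
Proof.
apply/eqP => /(congr1 (fun P : weyl => P 1)) /=; rewrite scale1r.
by move=> /eqP; rewrite oner_eq0.
Qed.

HB.instance Definition _ := GRing.Zmodule_isNzRing.Build weyl
  weyl_mulA weyl_mul1 weyl_mulr1 weyl_mulDl weyl_mulDr weyl1_neq0.

Lemma weylDE (P Q : weyl) p : (P + Q) p = P p + Q p. Proof. by []. Qed.
Lemma weylME (P Q : weyl) p : (P * Q) p = P (Q p). Proof. by []. Qed.

Lemma is_diffop_mul (r : R) : is_diffop (fun p => r * p).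
Proof.
elim/mpolyind: r => [|c m r _ _ ih].
  rewrite (_ : (fun p => _) = (fun p => 0 *: p)); first exact: DiffopC.
  by apply/funext => p; rewrite mul0r scale0r.
rewrite (_ : (fun p => _) = (fun p => c *: ('X_[m] * p) + r * p)); last first.
  by apply/funext => p; rewrite mulrDl -scalerAl.
apply: DiffopAdd => //.
apply: (DiffopComp (DiffopC c) (Q := fun p => 'X_[m] * p)).
rewrite mpolyXE_id; elim/big_rec: _ => [|i x _ ihx].
  rewrite (_ : (fun p => _) = (fun p => 1 *: p)); first exact: DiffopC.
  by apply/funext => p; rewrite mul1r scale1r.
elim: (m i) => [|n ihn].
  by rewrite expr0; under eq_fun do rewrite mul1r.
rewrite (_ : (fun p => _) = (fun p => 'X_i * ('X_i ^+ n * x * p))).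
  exact: (DiffopComp (DiffopX i) ihn).
by apply/funext => p; rewrite exprS !mulrA.
Qed.

Definition opM (r : R) : weyl := mkweyl (is_diffop_mul r).

Section Restriction.
Variable M : lmodType weyl.

(* M with its underlying structure of vector space over k. *)
Definition over_field : Type := M.

HB.instance Definition _ := GRing.Zmodule.on over_field.

Definition over_scale (c : k) (m : over_field) : over_field :=
  opC c *: (m : M).

Lemma over_scaleA a b m : over_scale a (over_scale b m) = over_scale (a * b) m.
Proof.
rewrite /over_scale scalerA; congr (_ *: _).
by apply: weylE => p /=; rewrite scalerA.
Qed.
Lemma over_scale1 : left_id 1 over_scale.
Proof. exact: scale1r. Qed.
Lemma over_scaleDr : right_distributive over_scale +%R.
Proof. move=> a m n; exact: scalerDr. Qed.
Lemma over_scaleDl m : {morph over_scale^~ m : a b / a + b}.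
Proof.
move=> a b; rewrite /over_scale (_ : opC _ = opC a + opC b) ?scalerDl //.
by apply: weylE => p /=; rewrite scalerDl.
Qed.

HB.instance Definition _ := GRing.Zmodule_isLmodule.Build k over_field
  over_scaleA over_scale1 over_scaleDr over_scaleDl.

Definition actD (i : 'I_2) (m : over_field) : over_field := opD i *: (m : M).

Lemma actD_is_linear i : linear (actD i).
Proof.
move=> c m n; rewrite /actD scalerDr; congr (_ + _).
transitivity (opD i *: (opC c *: (m : M))); first by [].
transitivity (opC c *: (opD i *: (m : M))); last by [].
rewrite !scalerA (_ : opD i * opC c = opC c * opD i) //.
by apply: weylE => p /=; rewrite linearZZ.
Qed.

HB.instance Definition _ i := GRing.isLinear.Build k over_field over_field _
  (actD i) (actD_is_linear i).

Lemma actD_comm i j m : actD i (actD j m) = actD j (actD i m).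
Proof.
rewrite /actD !scalerA (_ : opD i * opD j = opD j * opD i) //.
by apply: weylE => p /=; rewrite mderiv_comm.
Qed.

Definition DR : cochain k := form_complex actD_comm.

End Restriction.

Section LeftIdeal.
Variables (A : nzRingType) (S : A -> Prop).

Definition left_ideal : {pred A^o} := fun P =>
  `[< exists s : seq (A * A),
        (forall q, q \in s -> S q.2) /\ P = \sum_(q <- s) q.1 * q.2 >].

Lemma left_ideal_submod : subsemimod_closed left_ideal.
Proof.
split; first split; rewrite ?unfold_in.
- by apply/asboolP; exists [::]; rewrite big_nil.
- move=> P Q; rewrite !unfold_in => /asboolP [s [Ss ->]] /asboolP [t [St ->]].
  apply/asboolP; exists (s ++ t); rewrite big_cat; split=> // q.
  by rewrite mem_cat => /orP [/Ss | /St].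
- move=> a P; rewrite !unfold_in => /asboolP [s [Ss ->]].
  apply/asboolP; exists [seq (a * q.1, q.2) | q <- s]; split.
    by move=> q /mapP [r /Ss Sr ->].
  rewrite big_map /= scaler_sumr; apply: eq_bigr => q _.
  exact: (mulrA a q.1 q.2).
Qed.

HB.instance Definition _ :=
  GRing.isSubmodClosed.Build A A^o left_ideal left_ideal_submod.

End LeftIdeal.

Variable f : R.

Definition derivation (a : 'I_2 -> R) (g : R) : R :=
  \sum_i a i * mderiv i g.

(* Here h = delta(f) / f, which is determined by delta as soon as f != 0. *)
Definition twisted_log_der (P : weyl) : Prop :=
  exists (a : 'I_2 -> R) (h : R),
    derivation a f = h * f /\ P = \sum_i opM (a i) * opD i + opM h.

Definition Mlog : lmodType weyl := quotmod (left_ideal twisted_log_der).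

Definition Mlog_one : Mlog := quotpi (left_ideal twisted_log_der) (1 : weyl).

(* The element 1 (x) eta of Mlog (x)_R Omega^p_R, where 1 is the class of 1:  *)
(* 1 (x) (r dx_I) = (r . 1) (x) dx_I.                                         *)
Definition one_tensor (p : nat) (eta : dRform R p) : DR Mlog p :=
  @form_map k R (over_field Mlog) (fun r => opM r *: Mlog_one) p eta.

End Weyl.

Definition square_free (A : comUnitRingType) (f : A) : Prop :=
  forall g h, f = g ^+ 2 * h -> g \is a GRing.unit.

(* Main.v *)
Require Import Defs.
From HB Require Import structures.
From mathcomp Require Import all_boot all_order all_algebra.
From mathcomp Require Import boolp ring zify.
From mathcomp Require Import complex mpoly reals.

(* Every operator is uniquely a sum of terms d_2^j d_1^i r with r in R, so A_2 *)
(* is, as a right R-module, T = R[X1, X2], where X_i acts by left              *)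
(* multiplication by d_i. With I the left ideal of logarithmic operators, the  *)
(* de Rham complex of A_2 / I becomes the Koszul complex of (X1, X2) on T / I. *)
(* Moreover I consists of the elements X1 B1 + X2 B2 + C of T such that the    *)
(* coefficients of each monomial in (B1, B2, C) form a logarithmic derivation  *)
(* in the twisted sense.                                                       *)
(* The key point is that all syzygies of this presentation of I come from      *)
(* d_1 (d_2 f) = d_2 (d_1 f): looking at the terms of top degree, a syzygy     *)
(* gives a chain u_0 = 0, u_1, ..., u_{n+1} = 0 in R such that f divides all   *)
(* u_i f_y - u_{i+1} f_x, which forces f to divide every u_i because f is      *)
(* square-free (f | g f_x and f | g f_y imply f | g, using gcds in C[x,y]).    *)
(* Injectivity and surjectivity on cohomology then follow by comparing         *)
(* constant terms.                                                             *)

Set Implicit Arguments.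
Unset Strict Implicit.
Unset Printing Implicit Defensive.

Import GRing.Theory Num.Theory.
Local Open Scope ring_scope.

(** * Divisibility in bivariate polynomial rings *)

(** The comparison map sends w to 1 tensored with f w, so its values are written with symbols of
    degree 0 in X1, X2. Its source is explicit: for square-free f the logarithmic 0-forms are the
    polynomials ([log_form0P]), the 1-forms are the (a dx + b dy)/f with f dividing b f_x - a f_y
    ([log_form1P]), the 2-forms are the h dx dy / f ([log_form2P]). For the target, [quantize_inj],
    [quantize_surj], [quantize_log_ideal] and [log_ideal_quantize] replace the quotient of A_2 by
    that of T by [log_ideal], with d_1 and d_2 acting as X1 and X2.

    In degree 2, and for surjectivity in degree 1, a relation is split into its constant
    coefficients, which are the data of a logarithmic form, and its part of positive degree, which
    is absorbed by the ideal and by [symb_koszul]. In the other cases, relations multiplied by X1 or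
    X2 are combined so that their symbols cancel, and [syzygy] expresses the result through a symbol
    G. For injectivity in degree 1 the constant coefficient of G is, up to sign, a primitive of the
    given closed form; for surjectivity in degree 0 it is, up to sign, the constant function whose
    image is the given class.

    Square-freeness enters through [square_free_divides], used both for logarithmic 0-forms and, via
    [divides_chain], for the syzygies. *)

Definition divides (A : comNzRingType) (a b : A) : Prop := exists c, b = a * c.

Section Divides.
Variable A : comNzRingType.
Implicit Types a b c : A.

Lemma divides_refl a : divides a a.
Proof. by exists 1; rewrite mulr1. Qed.

Lemma divides_mulr a b c : divides a b -> divides a (b * c).
Proof. by move=> [d ->]; exists (d * c); rewrite mulrA. Qed.

Lemma divides_mull a b c : divides a b -> divides a (c * b).
Proof. by rewrite mulrC; exact: divides_mulr. Qed.

Lemma dividesD a b c : divides a b -> divides a c -> divides a (b + c).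
Proof. by move=> [d ->] [e ->]; exists (d + e); rewrite mulrDr. Qed.

Lemma dividesN a b : divides a b -> divides a (- b).
Proof. by move=> [d ->]; exists (- d); rewrite mulrN. Qed.

Lemma dividesB a b c : divides a b -> divides a c -> divides a (b - c).
Proof. by move=> ab ac; apply: dividesD => //; exact: dividesN. Qed.

Lemma divides0 a : divides a 0.
Proof. by exists 0; rewrite mulr0. Qed.

End Divides.

(** * Gauss's lemma and coprime elements in k[y][x] *)

Section GaussLemma.
Variable k : closedFieldType.
Implicit Types (l : {poly k}) (a b h p q : {poly {poly k}}).

Local Notation ev c := (map_poly (horner_eval c)).

Lemma divides_linear c p : ev c p = 0 -> divides ('X - c%:P)%:P p.
Proof.
move=> pc0; exists (map_poly (fun l => l %/ ('X - c%:P)) p).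
apply/polyP=> i; rewrite coefCM coef_map_id0 ?div0p // mulrC divpK //.
rewrite dvdp_XsubCl; apply/rootP.
by have := congr1 (fun q : {poly k} => q`_i) pc0; rewrite coef_map coef0.
Qed.

(** Setting the inner variable to c is a ring morphism to a domain, and its kernel is generated by
    'X - c. *)
Lemma linear_prime c p q :
  divides ('X - c%:P)%:P (p * q) ->
  divides ('X - c%:P)%:P p \/ divides ('X - c%:P)%:P q.
Proof.
move=> [r e]; have : ev c (p * q) = 0.
  by rewrite e rmorphM /= map_polyC /= /horner_eval hornerXsubC subrr mul0r.
rewrite rmorphM => /eqP; rewrite mulf_eq0 => /orP[] /eqP h.
  by left; exact: divides_linear.
by right; exact: divides_linear.
Qed.

(** As k is closed, l is a product of linear factors; each is prime in k[y][x] and is removed in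
    turn from q or from a. *)
Lemma gauss_split l h q a : l != 0 -> l%:P * h = q * a ->
  exists l1 l2 q' a',
    [/\ l = l1 * l2, q = l1%:P * q', a = l2%:P * a' & h = q' * a'].
Proof.
elim: {l}_.+1 {-2}l h q a (ltnSn (size l)) => // n IHn l h q a ln l0 e.
have [/size_poly1P[c c0 lc] | l1] := boolP (size l == 1).
  exists l, 1, (c^-1%:P%:P * q), a; split; rewrite ?mulr1 ?mul1r //.
    by rewrite lc mulrA -!rmorphM mulfV // mul1r.
  by rewrite -mulrA -e lc mulrA -!rmorphM mulVf // mul1r.
have [c /factor_theorem[l' lE]] := closed_rootP _ l1.
rewrite lE mulf_eq0 negb_or in l0; case/andP: l0 => l'0 c0.
have ln' : (size l' < n)%N.
  by move: ln; rewrite lE size_Mmonic ?monicXsubC // size_XsubC addn2.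
have C0 : ('X - c%:P)%:P != 0 :> {poly {poly k}} by rewrite polyC_eq0.
have : divides ('X - c%:P)%:P (q * a).
  by exists (l'%:P * h); rewrite -e lE rmorphM mulrCA mulrA.
case/linear_prime=> -[r rE]; move: e.
- rewrite rE lE [l' * _]mulrC rmorphM -!mulrA => /(mulfI C0) e.
  have [l1' [l2 [q' [a' [l'E rE' aE hE]]]]] := IHn _ _ _ _ ln' l'0 e.
  exists (('X - c%:P) * l1'), l2, q', a'; split=> //.
    by rewrite l'E mulrA.
  by rewrite rE' mulrA -rmorphM.
- rewrite rE lE [l' * _]mulrC rmorphM -!mulrA [q * _]mulrCA => /(mulfI C0) e.
  have [l1' [l2 [q' [a' [l'E qE rE' hE]]]]] := IHn _ _ _ _ ln' l'0 e.
  exists l1', (('X - c%:P) * l2), q', a'; split=> //.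
    by rewrite l'E mulrCA.
  by rewrite rE' mulrA -rmorphM.
Qed.

Definition primitive p := forall l p', p = l%:P * p' -> size l = 1%N.

(** Extracting a nonconstant factor lowers the degree of the leading coefficient, which is the
    induction measure. *)
Lemma primitive_part p : p != 0 -> exists l p', p = l%:P * p' /\ primitive p'.
Proof.
elim: {p}_.+1 {-2}p (ltnSn (size (lead_coef p))) => // n IHn p pn p0.
have [pP | /existsNP[l /existsNP[p' /not_implyP[pE l1]]]] := EM (primitive p).
  by exists 1, p; rewrite mul1r.
have /andP[l0 p'0] : (l != 0) && (p' != 0).
  by rewrite -negb_or -(@polyC_eq0 _ l) -mulf_eq0 -pE.
have [|//|l' [q [p'E qP]]] := IHn p'.
  move: pn; rewrite pE lead_coefM lead_coefC size_mul ?lead_coef_eq0 //.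
  move/eqP: l1; have := l0; rewrite -size_poly_gt0.
  case: (size l) => [|[|m]] //.
  by rewrite !addSn /= => _ _; rewrite ltnS; exact/leq_ltn_trans/leq_addl.
by exists (l * l'), q; rewrite rmorphM -mulrA -p'E.
Qed.


(** [gcdp] is a gcd only up to nonzero factors in k[y], but its primitive part truly divides a and b
    by Gauss's lemma, hence is a unit. So u a + v b = c for some nonzero c in k[y], and
    [gauss_split], used twice, removes c. *)
Lemma coprime_divides a b : a != 0 ->
  (forall e, divides e a -> divides e b -> e \is a GRing.unit) ->
  forall h, divides a (b * h) -> divides a h.
Proof.
move=> a0 cop.
have cst l : l != 0 -> l%:P \is a @GRing.unit {poly {poly k}} -> size l = 1%N.
  move=> l0; rewrite poly_unitE size_polyC l0 coefC /= poly_unitE.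
  by case/andP => /eqP.
have g0 : gcdp a b != 0 by rewrite gcdp_eq0 negb_and a0.
have [l [d [gE dP]]] := primitive_part g0.
have true_div p : gcdp a b %| p -> divides d p.
  case/Pdiv.Idomain.dvdpP => -[c q] /= c0 cE.
  have [l1 [l2 [q' [d' [_ _ dE pE]]]]] : exists l1 l2 q' a',
    [/\ c = l1 * l2, q * l%:P = l1%:P * q', d = l2%:P * a' & p = q' * a'].
    by apply: gauss_split => //; rewrite mul_polyC cE gE mulrA.
  have /eqP/size_poly1P[c2 c20 l2E] := dP _ _ dE.
  exists (c2^-1%:P%:P * q').
  by rewrite pE dE l2E mulrCA -mulrA mulrA -!rmorphM mulVf // mul1r mulrC.
have dU := cop _ (true_div _ (dvdp_gcdl a b)) (true_div _ (dvdp_gcdr a b)).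
have : coprimep a b.
  have d1 : size d = 1%N by move: dU; rewrite poly_unitE => /andP[/eqP].
  have /andP[l0 d0] : (l != 0) && (d != 0).
    by rewrite -negb_or -(@polyC_eq0 _ l) -mulf_eq0 -gE.
  by rewrite /coprimep gE size_mul ?polyC_eq0 // d1 size_polyC l0.
case/Bezout_coprimepP => -[u v] /=; rewrite -size_poly_eq1.
case/size_poly1P=> c c0 cE.
move=> h [t tE].
(* Since b h = a t, c h = (u h + v t) a, and the factors of c are shared between u h + v t and a. *)
have [l1 [l2 [q [a' [_ _ aE hE]]]]] : exists l1 l2 q' a',
    [/\ c = l1 * l2, u * h + v * t = l1%:P * q', a = l2%:P * a' & h = q' * a'].
  apply: gauss_split => //; rewrite -cE.
  transitivity (u * h * a + v * (b * h)); [ring | rewrite tE; ring].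
have /andP[l20 a'0] : (l2 != 0) && (a' != 0).
  by rewrite -negb_or -(@polyC_eq0 _ l2) -mulf_eq0 -aE.
(* The part m1 of l2 that divides b also divides a, so it is a constant; the other part m2 divides
   q. *)
have /(gauss_split l20)[m1 [m2 [b' [q' [l2E bE qE _]]]]] : l2%:P * t = b * q.
  apply: (mulIf a'0); transitivity (b * h); last by rewrite hE mulrA.
  by rewrite tE aE mulrAC.
have m10 : m1 != 0 by move: l20; rewrite l2E mulf_eq0 => /norP[].
have /eqP/size_poly1P[c1 c10 m1E] : size m1 = 1%N.
  apply: cst => //; apply: cop; last by exists b'.
  by exists (m2%:P * a'); rewrite aE l2E rmorphM mulrA.
exists (c1^-1%:P%:P * q').
rewrite hE qE aE l2E m1E rmorphM.
transitivity (m2%:P * q' * a' * (c1%:P%:P * c1^-1%:P%:P)); last ring.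
by rewrite -!rmorphM mulfV // !rmorph1 mulr1.
Qed.

End GaussLemma.

Lemma ord2P (P : 'I_2 -> Prop) : P ix -> P iy -> forall i, P i.
Proof.
move=> Px Py [[|[|//]] h].
  by rewrite (_ : Ordinal h = ix) //; exact: val_inj.
by rewrite (_ : Ordinal h = iy) //; exact: val_inj.
Qed.

Section BivariatePolynomials.
Variable k : closedFieldType.
Notation R := {mpoly k[2]}.

Definition iterated_var (i : 'I_2) : {poly {poly k}} :=
  if i == ix then 'X else 'X%:P.
Definition to_iterated : R -> {poly {poly k}} :=
  mmap (@polyC {poly k} \o @polyC k) iterated_var.
HB.instance Definition _ := GRing.RMorphism.on to_iterated.

Definition of_iterated : {poly {poly k}} -> R :=
  horner_eval 'X_ix \o map_poly (horner_eval 'X_iy \o map_poly (@mpolyC 2 k)).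
HB.instance Definition _ := GRing.RMorphism.on of_iterated.

Lemma to_iteratedC c : to_iterated c%:MP = c%:P%:P.
Proof. exact: mmapC. Qed.
Lemma to_iteratedX i : to_iterated 'X_i = iterated_var i.
Proof. by rewrite /to_iterated mmapX mmap1U. Qed.
Lemma of_iteratedC p : of_iterated p%:P = (map_poly (@mpolyC 2 k) p).['X_iy].
Proof. by rewrite /of_iterated /= map_polyC /= /horner_eval hornerC. Qed.

Lemma to_iteratedK : cancel to_iterated of_iterated.
Proof.
move=> r; elim/mpolyind: r => [|c m r _ _ ih]; first by rewrite !rmorph0.
rewrite !rmorphD /= ih -mul_mpolyC !rmorphM /= to_iteratedC of_iteratedC.
rewrite map_polyC hornerC; congr (_ * _ + _).
rewrite mpolyXE_id !rmorph_prod; apply: eq_bigr => i _.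
rewrite !rmorphXn /= to_iteratedX; congr (_ ^+ _).
elim/ord2P: i; rewrite /iterated_var /=.
  by rewrite /of_iterated /= map_polyX /horner_eval hornerX.
by rewrite of_iteratedC map_polyX hornerX.
Qed.

Lemma of_iteratedK : cancel of_iterated to_iterated.
Proof.
move=> p; elim/poly_ind: p => [|p q ih]; first by rewrite !rmorph0.
rewrite !rmorphD !rmorphM /= ih; congr (_ * _ + _).
  by rewrite /of_iterated /= map_polyX /horner_eval hornerX to_iteratedX.
elim/poly_ind: q => [|q c ihq]; first by rewrite !rmorph0.
rewrite 3!rmorphD 3!rmorphM /= ihq; congr (_ * _ + _).
  by rewrite of_iteratedC map_polyX hornerX to_iteratedX.
by rewrite of_iteratedC map_polyC hornerC to_iteratedC.
Qed.

Lemma mpoly_coprime_divides (a b : R) : a != 0 ->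
  (forall e, divides e a -> divides e b -> e \is a GRing.unit) ->
  forall h, divides a (b * h) -> divides a h.
Proof.
move=> a0 cop h [t tE].
have [|||u uE] := @coprime_divides k (to_iterated a) (to_iterated b) _ _
  (to_iterated h).
- by rewrite -(rmorph0 to_iterated) (can_eq to_iteratedK).
- move=> e [u uE] [v vE]; rewrite -[e]of_iteratedK; apply/rmorph_unit/cop.
    by exists (of_iterated u); rewrite -[LHS]to_iteratedK uE rmorphM.
  by exists (of_iterated v); rewrite -[LHS]to_iteratedK vE rmorphM.
- by exists (to_iterated t); rewrite -!rmorphM tE.
- exists (of_iterated u).
  by rewrite -[LHS]to_iteratedK uE rmorphM /= to_iteratedK.
Qed.

End BivariatePolynomials.

Section Msize.
Variables (n : nat) (k : fieldType).
Implicit Types p a b : {mpoly k[n]}.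

Lemma mpoly_unitE p : (p \is a GRing.unit) = (msize p == 1%N).
Proof.
apply/idP/msize_poly1P => [|[c c0 ->]].
  by case/andP => /eqP pE u; exists p@_0%MM; rewrite // -unitfE.
by rewrite rmorph_unit // unitfE.
Qed.

Lemma msize_nonunit p : p != 0 -> p \isn't a GRing.unit -> (1 < msize p)%N.
Proof.
by move=> p0; rewrite mpoly_unitE (mpolySpred _ p0) ltnS lt0n.
Qed.

Lemma gcd_decomposition a b : a != 0 -> exists d a' b',
  [/\ a = d * a', b = d * b'
    & forall e, divides e a' -> divides e b' -> e \is a GRing.unit].
Proof.
elim: {a}_.+1 {-2}a b (ltnSn (msize a)) => // m IHm a b am a0.
have [cop | /existsNP[e]] := EM (forall e, divides e a -> divides e b ->
  e \is a GRing.unit); first by exists 1, a, b; rewrite !mul1r.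
move=> /not_implyP[[a1 aE] /not_implyP[[b1 bE] /negP eU]].
have /andP[e0 a10] : (e != 0) && (a1 != 0) by rewrite -negb_or -mulf_eq0 -aE.
have [|//|d [a' [b' [a1E b1E cop]]]] := IHm a1 b1.
  move: am; rewrite aE msizeM // (mpolySpred _ a10) addnS /= ltnS.
  by apply: leq_trans; rewrite -add2n leq_add2r msize_nonunit.
by exists (e * d), a', b'; rewrite -!mulrA -a1E -b1E.
Qed.

Lemma msize_mderiv i p : mderiv i p != 0 -> (msize (mderiv i p) < msize p)%N.
Proof.
move=> dp0; rewrite -mlead_deg //.
have := mlead_supp dp0; set m := mlead _.
rewrite mcoeff_msupp mcoeff_deriv => pm.
have : (m + U_(i))%MM \in msupp p.
  by rewrite mcoeff_msupp; apply: contraNneq pm => ->; rewrite mul0rn.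
by move/msize_mdeg_lt; rewrite mdegD mdeg1 addn1.
Qed.

(** A nonzero derivative has smaller degree than p, so it is no multiple of p. *)
Lemma divides_mderiv_eq0 i p : divides p (mderiv i p) -> mderiv i p = 0.
Proof.
move=> [q e]; apply/eqP/negPn/negP => dp0.
have := msize_mderiv dp0; have /andP[p0 q0] : (p != 0) && (q != 0).
  by rewrite -negb_or -mulf_eq0 -e.
by rewrite e msizeM // (mpolySpred _ q0) addnS ltnNge leq_addr.
Qed.

End Msize.

Lemma mderiv_eq0_const n (k : numFieldType) (p : {mpoly k[n]}) :
  (forall i, mderiv i p = 0) -> p = (p@_0%MM)%:MP.
Proof.
move=> dp0; apply/mpolyP => m; rewrite mcoeffC.
have [->|m0] := eqVneq m 0%MM; first by rewrite mulr1.
have [i mi] : exists i, m i != 0%N.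
  apply/existsP; apply: contra_neqT m0; rewrite negb_exists => /forallP m0.
  by apply/mnmP => i; rewrite mnmE; apply/eqP/negPn.
rewrite mulr0; have := congr1 (mcoeff (m - U_(i))%MM) (dp0 i).
rewrite mcoeff_deriv mcoeff0 submK ?lep1mP // => /eqP.
by rewrite mulrn_eq0 /= => /eqP.
Qed.

(** * Removing partial derivatives of a square-free polynomial from divisibilities *)

Section SquareFree.
Variables (k : numClosedFieldType) (f : {mpoly k[2]}).
Hypotheses (f0 : f != 0) (f_sqf : square_free f).

(** Let d be the gcd of f and g, and f = d f'. Then f' divides the partial derivatives of f, hence d
    times those of f'. As f is square-free, d and f' are coprime, so f' divides its own derivatives;
    these vanish and f' is constant. *)
Lemma square_free_divides g :
  (forall i, divides f (g * mderiv i f)) -> divides f g.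
Proof.
move=> fg; have [d [f' [g' [fE gE cop]]]] := gcd_decomposition g f0.
have /andP[d0 f'0] : (d != 0) && (f' != 0) by rewrite -negb_or -mulf_eq0 -fE.
have df' i : mderiv i f' = 0.
  apply: divides_mderiv_eq0; apply: (@mpoly_coprime_divides _ _ d) => //.
    move=> e [u uE] [v vE]; apply: (f_sqf (h := u * v)).
    by rewrite fE uE vE expr2; ring.
  have : divides f' (mderiv i f).
    apply: (mpoly_coprime_divides f'0 cop); have [t tE] := fg i.
    by exists t; apply: (mulfI d0); rewrite mulrA -gE tE {1}fE mulrA.
  rewrite fE mderivM => h; rewrite -[X in divides _ X](addKr (mderiv i d * f')).
  by apply: dividesD => //; apply/dividesN/divides_mull/divides_refl.
have f'U : f' \is a GRing.unit.
  rewrite mpoly_unitE; apply/msize_poly1P; exists f'@_0%MM.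
    by apply: contraNneq f'0 => h; rewrite (mderiv_eq0_const df') h.
  exact: mderiv_eq0_const.
by exists (f'^-1 * g'); rewrite fE gE -mulrA mulVKr.
Qed.

Lemma square_free_divides_exp g m n :
  divides f (g * mderiv ix f ^+ m) -> divides f (g * mderiv iy f ^+ n) ->
  divides f g.
Proof.
elim: m => [|m IHm]; first by rewrite mulr1.
rewrite exprSr mulrA => hx hy; apply: (IHm _ hy) => {IHm}.
have {}hy : divides f (g * mderiv ix f ^+ m * mderiv iy f ^+ n).
  by rewrite mulrAC; exact: divides_mulr.
move: (g * _) hx hy => {}g hx; elim: n => [|n IHn]; first by rewrite mulr1.
rewrite exprSr mulrA => hy; apply: IHn; apply: square_free_divides.
by apply: ord2P => //; rewrite mulrAC; exact: divides_mulr.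
Qed.

End SquareFree.

(** * Symbols of differential operators *)

(* An element of {poly {poly R}} is a polynomial over R in X1 (the inner       *)
(* variable) and X2 (the outer one). The operations are locked because         *)
(* unification would otherwise unfold mderiv and the nested products.          *)

Reserved Notation "r %:S" (at level 2, format "r %:S").

HB.lock Definition symb_const (k : fieldType) (r : {mpoly k[2]}) :
  {poly {poly {mpoly k[2]}}} := r%:P%:P.

HB.lock Definition symb_var (k : fieldType) (i : 'I_2) :
  {poly {poly {mpoly k[2]}}} := if i == ix then 'X%:P else 'X.

HB.lock Definition symb_coef (k : fieldType) (p : {poly {poly {mpoly k[2]}}})
  (i j : nat) : {mpoly k[2]} := p`_j`_i.

HB.lock Definition symb_deriv (k : fieldType) (i : 'I_2)
    (p : {poly {poly {mpoly k[2]}}}) : {poly {poly {mpoly k[2]}}} :=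
  map_poly (map_poly (mderiv i)) p.

Local Notation "r %:S" := (symb_const r) : ring_scope.

Section Symbols.
Variable k : fieldType.
Notation R := {mpoly k[2]}.
Local Notation symb := {poly {poly R}}.

Local Notation X1 := (symb_var k ix).
Local Notation X2 := (symb_var k iy).
Local Notation D := symb_deriv.
Local Notation cf := symb_coef.

Implicit Types (p q : symb) (r : R).

Fact symb_const_is_zmod_morphism : zmod_morphism (@symb_const k).
Proof. by move=> r s; rewrite unlock !rmorphB. Qed.
Fact symb_const_is_monoid_morphism : monoid_morphism (@symb_const k).
Proof. by split=> [|r s]; rewrite unlock ?rmorph1 ?rmorphM. Qed.
HB.instance Definition _ :=
  GRing.isZmodMorphism.Build R symb (@symb_const k) symb_const_is_zmod_morphism.
HB.instance Definition _ :=
  GRing.isMonoidMorphism.Build R symb (@symb_const k)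
    symb_const_is_monoid_morphism.

Lemma symb_const0 : 0%:S = 0 :> symb.
Proof. exact: rmorph0. Qed.
Lemma symb_constN r : (- r)%:S = - r%:S.
Proof. exact: rmorphN. Qed.
Lemma symb_constM r s : (r * s)%:S = r%:S * s%:S.
Proof. exact: rmorphM. Qed.

Fact symb_deriv_is_zmod_morphism i : zmod_morphism (@symb_deriv k i).
Proof. by move=> r s; rewrite unlock raddfB. Qed.
HB.instance Definition _ i :=
  GRing.isZmodMorphism.Build symb symb (D i) (symb_deriv_is_zmod_morphism i).

Lemma symb_derivD i p q : D i (p + q) = D i p + D i q.
Proof. exact: raddfD. Qed.
Lemma symb_derivN i p : D i (- p) = - D i p.
Proof. exact: raddfN. Qed.
Lemma symb_derivB i p q : D i (p - q) = D i p - D i q.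
Proof. exact: raddfB. Qed.

Lemma symb_coefP p q : (forall i j, cf p i j = cf q i j) -> p = q.
Proof.
move=> pq; apply/polyP => j; apply/polyP => i.
by have := pq i j; rewrite unlock.
Qed.

Lemma symb_coefD p q i j : cf (p + q) i j = cf p i j + cf q i j.
Proof. by rewrite !unlock !coefD. Qed.
Lemma symb_coefN p i j : cf (- p) i j = - cf p i j.
Proof. by rewrite !unlock !coefN. Qed.
Lemma symb_coef0 i j : cf (0 : symb) i j = 0.
Proof. by rewrite !unlock !coef0. Qed.
Lemma symb_coef_const r i j :
  cf r%:S i j = if (i == 0%N) && (j == 0%N) then r else 0.
Proof.
rewrite !unlock coefC.
by case: j => [|j]; case: i => [|i]; rewrite /= ?coefC ?coef0.
Qed.
Lemma symb_coefCM r p i j : cf (r%:S * p) i j = r * cf p i j.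
Proof. by rewrite !unlock !coefCM. Qed.
Lemma symb_coefMC r p i j : cf (p * r%:S) i j = cf p i j * r.
Proof. by rewrite !unlock !coefMC. Qed.
Lemma symb_coefXM p i j : cf (X1 * p) i j = if i is i'.+1 then cf p i' j else 0.
Proof. by rewrite symb_coef.unlock symb_var.unlock /= coefCM coefXM; case: i. Qed.
Lemma symb_coefYM p i j : cf (X2 * p) i j = if j is j'.+1 then cf p i j' else 0.
Proof.
rewrite symb_coef.unlock symb_var.unlock /= coefXM.
by case: j => //=; rewrite coef0.
Qed.
Lemma symb_coef_deriv l p i j : cf (D l p) i j = mderiv l (cf p i j).
Proof. by rewrite !unlock !coef_map. Qed.

Definition symb_coefE := (symb_coefD, symb_coefN, symb_coef_const,
  symb_coefCM, symb_coefMC, symb_coefXM, symb_coefYM, symb_coef_deriv).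

Lemma symb_derivC i r : D i r%:S = (mderiv i r)%:S.
Proof.
by apply: symb_coefP => a b; rewrite !symb_coefE; case: ifP; rewrite ?mderiv0.
Qed.

Lemma symb_derivCM i r p : D i (r%:S * p) = (mderiv i r)%:S * p + r%:S * D i p.
Proof. by apply: symb_coefP => a b; rewrite !symb_coefE mderivM. Qed.

Lemma symb_derivXM i j p : D i (symb_var k j * p) = symb_var k j * D i p.
Proof.
apply: symb_coefP => a b; rewrite symb_coef_deriv.
elim/ord2P: j; rewrite !symb_coefE ?symb_coef_deriv.
  by case: a => [|a]; rewrite ?mderiv0 ?symb_coef_deriv.
by case: b => [|b]; rewrite ?mderiv0 ?symb_coef_deriv.
Qed.

Lemma symb_deriv_comm i j p : D i (D j p) = D j (D i p).
Proof. by apply: symb_coefP => a b; rewrite !symb_coefE mderiv_comm. Qed.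

Lemma symb_degree p : exists n, forall i j, (n <= i + j)%N -> cf p i j = 0.
Proof.
exists (size p + \max_(j < size p) size (p`_j)%R)%N => i j nij.
have [pj|jp] := leqP (size p) j; first by rewrite unlock (nth_default _ pj) coef0.
rewrite unlock; apply: nth_default; rewrite -(leq_add2r j).
apply: leq_trans nij; rewrite addnC.
apply: leq_add; first exact: ltnW.
exact: (@leq_bigmax _ (fun j : 'I_(size p) => size p`_j) (Ordinal jp)).
Qed.

End Symbols.

(** * Syzygies of the logarithmic relations *)

Section LogSymbols.
Variables (k : numClosedFieldType) (f : {mpoly k[2]}).
Hypotheses (f0 : f != 0) (f_sqf : square_free f).
Notation R := {mpoly k[2]}.
Local Notation T := {poly {poly R}}.
Local Notation X1 := (symb_var k ix).
Local Notation X2 := (symb_var k iy).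
Local Notation D := symb_deriv.
Local Notation cf := symb_coef.
Local Notation fx := (mderiv ix f).
Local Notation fy := (mderiv iy f).

(** Going up from u_0 = 0, f divides u_i f_x^i; going down from u_(n+1) = 0, f divides u_i
    f_y^(n+1-i). Square-freeness removes both powers. *)
Lemma divides_chain (u : nat -> R) n : u 0%N = 0 -> u n.+1 = 0 ->
  (forall i, (i <= n)%N -> divides f (u i * fy - u i.+1 * fx)) ->
  forall i, (i <= n.+1)%N -> divides f (u i).
Proof.
move=> u0 un du i ile.
apply: (square_free_divides_exp f0 f_sqf (m := i) (n := n.+1 - i)).
  elim: i ile => [|i IHi] ile; first by rewrite u0 mul0r; exact: divides0.
  rewrite (_ : _ * _ = (u i * fx ^+ i) * fy - (u i * fy - u i.+1 * fx) * fx ^+ i).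
    apply: dividesB; apply: divides_mulr; first exact/IHi/ltnW.
    exact: du.
  by rewrite exprS; ring.
rewrite -[i in u i](subKn ile).
elim: (n.+1 - i)%N (leq_subr i n.+1) => [|j IHj] jle.
  by rewrite subn0 un mul0r; exact: divides0.
have := IHj (ltnW jle); rewrite -(subnSK jle) => h.
rewrite (_ : _ * _ = (u (n.+1 - j.+1)%N * fy - u (n.+1 - j.+1).+1 * fx) * fy ^+ j
  + (u (n.+1 - j.+1).+1 * fy ^+ j) * fx); last by rewrite exprS; ring.
apply: dividesD; apply: divides_mulr => //; apply: du.
by rewrite subSS leq_subr.
Qed.

(* For constants a, b, c this says that d_1 a + d_2 b + c, that is             *)
(* a d_1 + b d_2 + (c + a_x + b_y), is a twisted logarithmic derivation.       *)
Definition log_rel (B1 B2 C : T) : Prop :=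
  B1 * fx%:S + B2 * fy%:S = (C + D ix B1 + D iy B2) * f%:S.

Definition log_ideal (p : T) : Prop :=
  exists B1 B2 C, log_rel B1 B2 C /\ p = X1 * B1 + X2 * B2 + C.

(* The syzygies deduced from d_1 (d_2 f) = d_2 (d_1 f) by left multiplication  *)
(* by the operator with symbol G.                                              *)
Definition syz1 (G : T) : T := f%:S * (D iy G - X2 * G).
Definition syz2 (G : T) : T := f%:S * (X1 * G - D ix G).

(** The difference of the two sides of [log_rel] once C is eliminated by X1 B1 + X2 B2 + C = 0. *)
Let defect (B1 B2 : T) : T :=
  f%:S * (X1 * B1 - D ix B1 + X2 * B2 - D iy B2) + B1 * fx%:S + B2 * fy%:S.

Lemma defect_syz G : defect (syz1 G) (syz2 G) = 0.
Proof.
rewrite /defect /syz1 /syz2 !symb_derivCM !symb_derivB !symb_derivXM.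
by rewrite (symb_deriv_comm iy ix); ring.
Qed.

Lemma defectB B1 B2 B1' B2' :
  defect (B1 - B1') (B2 - B2') = defect B1 B2 - defect B1' B2'.
Proof. by rewrite /defect !symb_derivB; ring. Qed.

(** Induction on a strict bound for the total degree in X1, X2: the top parts of B1 and B2 are those
    of the syzygy of a homogeneous G0 of one degree less, and subtracting this syzygy lowers the
    bound. *)
Lemma syzygy_aux n B1 B2 :
  (forall i j, (n <= i + j)%N -> cf B1 i j = 0) ->
  (forall i j, (n <= i + j)%N -> cf B2 i j = 0) ->
  defect B1 B2 = 0 -> exists G, B1 = syz1 G /\ B2 = syz2 G.
Proof.
elim: n B1 B2 => [|n IHn] B1 B2 hB1 hB2 dB.
  exists 0; split; apply: symb_coefP => i j.
    by rewrite hB1 // /syz1 raddf0 !mulr0 subr0 mulr0 symb_coef0.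
  by rewrite hB2 // /syz2 raddf0 !mulr0 subr0 mulr0 symb_coef0.
(* The default value supplies the end u_(n+1) = 0 of the chain. *)
pose u i := if (i <= n)%N then cf B2 i (n - i) else 0.
(* In degree n + 1 only f (X1 B1 + X2 B2) contributes to the defect, and f cancels. *)
have top i j : (i + j)%N = n.+1 ->
    (if i is i'.+1 then cf B1 i' j else 0)
    + (if j is j'.+1 then cf B2 i j' else 0) = 0.
  move=> ij; have := congr1 (fun p => cf p i j) dB.
  rewrite symb_coef0 /defect !symb_coefE.
  rewrite hB1 ?hB2 ?ij // !mderiv0 !(mul0r, addr0, subr0) => /eqP.
  by rewrite mulf_eq0 (negbTE f0) => /eqP.
have B1u i : (i <= n)%N -> cf B1 i (n - i) = - u i.+1.
  move=> ile; have := top i.+1 (n - i)%N; rewrite addSn subnKC // => /(_ erefl).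
  rewrite /u; case: ltnP => [lt_in|le_ni]; last first.
    by move: le_ni; rewrite -subn_eq0 => /eqP ->; rewrite addr0 oppr0.
  by rewrite -(subnSK lt_in) => /eqP; rewrite addr_eq0 => /eqP.
have u0 : u 0%N = 0 by have := top 0%N n.+1 erefl; rewrite /u subn0 add0r.
have un : u n.+1 = 0 by rewrite /u ltnn.
(* This is the defect in degree n, modulo f. *)
have du i : (i <= n)%N -> divides f (u i * fy - u i.+1 * fx).
  move=> ile; have := congr1 (fun p => cf p i (n - i)) dB.
  rewrite symb_coef0 /defect !(symb_coefD, symb_coefCM, symb_coefMC) B1u //.
  rewrite -(_ : u i = cf B2 i (n - i)); last by rewrite /u ile.
  set E := (X in f * X) => e; exists (- E).
  by apply/eqP; rewrite -subr_eq0 -e; apply/eqP; ring.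
have /choice[g gE] i : exists g, (i <= n.+1)%N -> u i = f * g.
  have [ile|] := leqP i n.+1; last by exists 0.
  by have [g ->] := divides_chain u0 un du ile; exists g.
(* The coefficient of X1^i X2^j is g_(i+1) when i + j = n - 1, so that - f X2 G0 and f X1 G0 are the
   top parts of B1 and B2. *)
pose G0 : T := \poly_(j < n) (g (n - j)%N *: 'X^(n.-1 - j)).
have G0E i j : cf G0 i j = if (i + j).+1 == n then g i.+1 else 0.
  rewrite unlock coef_poly; case: ltnP => [jn|nj].
    rewrite coefZ coefXn.
    have -> : (i == n.-1 - j)%N = ((i + j).+1 == n) by lia.
    by case: eqP => [<-|_]; rewrite ?mulr0 // mulr1 -addSn addnK.
  by rewrite coef0 gtn_eqF // ltnS; apply: leq_trans nj (leq_addl _ _).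
have G0z i j : (n <= i + j)%N -> cf G0 i j = 0.
  by move=> nij; rewrite G0E gtn_eqF.
have [|||G [B1E B2E]] := IHn (B1 - syz1 G0) (B2 - syz2 G0).
- move=> i j nij; rewrite symb_coefD symb_coefN symb_coefCM symb_coefD symb_coefN.
  rewrite symb_coef_deriv symb_coefYM (G0z _ _ nij) mderiv0 sub0r mulrN opprK.
  move: nij; rewrite leq_eqVlt => /predU1P[ijn|nij].
    have [jE ile] : j = (n - i)%N /\ (i <= n)%N by lia.
    rewrite {1}jE B1u //; case: j {jE} ijn => [|j] ijn.
      by rewrite mulr0 addr0 -(addn0 i) -ijn un oppr0.
    by rewrite G0E -addnS -ijn eqxx gE ?addNr // ltnS.
  rewrite hB1 // add0r; case: j nij => [|j] nij; first by rewrite mulr0.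
  by rewrite G0z ?mulr0 // -ltnS -addnS.
- move=> i j nij; rewrite symb_coefD symb_coefN symb_coefCM symb_coefD symb_coefN.
  rewrite symb_coef_deriv symb_coefXM (G0z _ _ nij) mderiv0 subr0.
  move: nij; rewrite leq_eqVlt => /predU1P[ijn|nij].
    have [jE ile] : j = (n - i)%N /\ (i <= n)%N by lia.
    rewrite {1}jE (_ : cf B2 _ _ = u i); last by rewrite /u ile.
    case: i {jE} ijn ile => [|i] ijn ile; first by rewrite mulr0 subr0.
    by rewrite G0E -addSn -ijn eqxx gE ?subrr // ltnW.
  rewrite hB2 // sub0r; case: i nij => [|i] nij; first by rewrite mulr0 oppr0.
  by rewrite G0z ?mulr0 ?oppr0 // -ltnS -addSn.
- by rewrite defectB dB defect_syz subr0.
exists (G + G0); split.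
  by rewrite /syz1 symb_derivD; rewrite -[LHS](subrK (syz1 G0)) B1E /syz1; ring.
by rewrite /syz2 symb_derivD; rewrite -[LHS](subrK (syz2 G0)) B2E /syz2; ring.
Qed.

Lemma syzygy B1 B2 C : log_rel B1 B2 C -> X1 * B1 + X2 * B2 + C = 0 ->
  exists G, B1 = syz1 G /\ B2 = syz2 G.
Proof.
move=> BC B0; have [n1 h1] := symb_degree B1; have [n2 h2] := symb_degree B2.
apply: (@syzygy_aux (maxn n1 n2)).
- by move=> i j; rewrite geq_max => /andP[? _]; exact: h1.
- by move=> i j; rewrite geq_max => /andP[_ ?]; exact: h2.
have CE : C = - (X1 * B1 + X2 * B2) by apply/eqP; rewrite -addr_eq0 addrC B0.
by rewrite /defect -addrA BC CE; ring.
Qed.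

End LogSymbols.

(** * The ideal of logarithmic symbols *)

Section Shifts.
Variable k : fieldType.
Local Notation T := {poly {poly {mpoly k[2]}}}.
Local Notation X1 := (symb_var k ix).
Local Notation X2 := (symb_var k iy).
Local Notation cf := symb_coef.
Implicit Types p q : T.

(** Nonconstant terms free of X2 are divided by X1, all terms containing X2 by X2. This choice only
    moves coefficients around, hence preserves [log_rel]. *)
Definition symb_shiftX p : T := (drop_poly 1 p`_0)%:P.
Definition symb_shiftY p : T := drop_poly 1 p.

Lemma symb_coef_shiftX p i j :
  cf (symb_shiftX p) i j = if j is 0%N then cf p i.+1 0 else 0.
Proof.
rewrite symb_coef.unlock /symb_shiftX coefC.
case: j => [|j] /=; last by rewrite coef0.
by rewrite coef_drop_poly addn1.
Qed.

Lemma symb_coef_shiftY p i j : cf (symb_shiftY p) i j = cf p i j.+1.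
Proof. by rewrite symb_coef.unlock coef_drop_poly addn1. Qed.

Lemma symb_decomp p :
  p = (cf p 0 0)%:S + X1 * symb_shiftX p + X2 * symb_shiftY p.
Proof.
apply: symb_coefP => i j; rewrite !symb_coefE.
by case: i => [|i]; case: j => [|j]; rewrite ?symb_coef_shiftX ?symb_coef_shiftY
  /= ?addr0 ?add0r.
Qed.

Lemma symb_varI i p q : symb_var k i * p = symb_var k i * q -> p = q.
Proof.
move=> e; apply: symb_coefP => a b; move: i e; apply: ord2P => e.
  by have := congr1 (fun p => cf p a.+1 b) e; rewrite !symb_coefXM.
by have := congr1 (fun p => cf p a b.+1) e; rewrite !symb_coefYM.
Qed.

Lemma symb_const_mulI (r : {mpoly k[2]}) p q :
  r != 0 -> r%:S * p = r%:S * q -> p = q.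
Proof.
move=> r0 e; apply: symb_coefP => i j; apply: (mulfI r0).
by have := congr1 (fun p => cf p i j) e; rewrite !symb_coefCM.
Qed.

Lemma symb_koszul p q : X1 * p = X2 * q -> exists s, p = X2 * s /\ q = X1 * s.
Proof.
move=> pq; have pE : p = X2 * symb_shiftY p.
  apply: symb_coefP => i [|j]; rewrite symb_coefYM ?symb_coef_shiftY //.
  by have := congr1 (fun p => cf p i.+1 0) pq; rewrite symb_coefXM symb_coefYM.
exists (symb_shiftY p); split=> //; apply: (@symb_varI iy).
by rewrite -pq {1}pE mulrCA.
Qed.

(** Each coefficient p_(i,j) is the y-derivative of p_(i,j+1); iterating leads beyond the degree of
    p, where coefficients vanish. *)
Lemma symb_var_deriv_eq0 p : X2 * p = symb_deriv iy p -> p = 0.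
Proof.
move=> e; have [n pn] := symb_degree p.
suff h m i j : (n <= i + j + m)%N -> cf p i j = 0.
  apply: symb_coefP => i j; rewrite symb_coef0; apply: (h n); exact: leq_addl.
elim: m i j => [|m IHm] i j nij; first by rewrite pn // -[(i + j)%N]addn0.
have := congr1 (fun p => cf p i j.+1) e.
rewrite symb_coefYM symb_coef_deriv => ->.
by rewrite IHm ?mderiv0 // addnS addSnnS.
Qed.

End Shifts.

(** * Koszul cohomology of T modulo the logarithmic ideal *)

Section LogCohomology.
Variables (k : numClosedFieldType) (f : {mpoly k[2]}).
Hypotheses (f0 : f != 0) (f_sqf : square_free f).
Notation R := {mpoly k[2]}.
Local Notation T := {poly {poly R}}.
Local Notation X1 := (symb_var k ix).
Local Notation X2 := (symb_var k iy).
Local Notation D := symb_deriv.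
Local Notation cf := symb_coef.
Local Notation fx := (mderiv ix f).
Local Notation fy := (mderiv iy f).
Local Notation sx := (@symb_shiftX k).
Local Notation sy := (@symb_shiftY k).
Implicit Types (a b c g h : R) (B P Q S : T).

Lemma log_relP B1 B2 C : log_rel f B1 B2 C <-> forall i j,
  cf B1 i j * fx + cf B2 i j * fy =
  (cf C i j + mderiv ix (cf B1 i j) + mderiv iy (cf B2 i j)) * f.
Proof.
split=> [h i j|h].
  by have := congr1 (fun p => cf p i j) h; rewrite !symb_coefE.
by apply: symb_coefP => i j; rewrite !symb_coefE h.
Qed.

Lemma log_rel_const a b c :
  log_rel f a%:S b%:S c%:S <->
  a * fx + b * fy = (c + mderiv ix a + mderiv iy b) * f.
Proof.
rewrite log_relP; split=> [/(_ 0 0)%N|h i j]; first by rewrite !symb_coef_const.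
by rewrite !symb_coef_const; case: ifP; rewrite // !mderiv0 !mul0r !addr0 mul0r.
Qed.

Lemma log_relD B1 B2 C B1' B2' C' : log_rel f B1 B2 C -> log_rel f B1' B2' C' ->
  log_rel f (B1 + B1') (B2 + B2') (C + C').
Proof.
rewrite /log_rel !symb_derivD => e e'.
by rewrite !mulrDl addrACA e e'; ring.
Qed.

Lemma log_relN B1 B2 C : log_rel f B1 B2 C -> log_rel f (- B1) (- B2) (- C).
Proof. by rewrite /log_rel !symb_derivN !mulNr -opprD => ->; ring. Qed.

Lemma log_relB B1 B2 C B1' B2' C' : log_rel f B1 B2 C -> log_rel f B1' B2' C' ->
  log_rel f (B1 - B1') (B2 - B2') (C - C').
Proof. by move=> h /log_relN; exact: log_relD. Qed.

Lemma log_relX i B1 B2 C : log_rel f B1 B2 C ->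
  log_rel f (symb_var k i * B1) (symb_var k i * B2) (symb_var k i * C).
Proof. by rewrite /log_rel !symb_derivXM -!mulrA -mulrDr => ->; ring. Qed.

Lemma log_relXI i B1 B2 C :
  log_rel f (symb_var k i * B1) (symb_var k i * B2) (symb_var k i * C) ->
  log_rel f B1 B2 C.
Proof.
rewrite /log_rel !symb_derivXM -!mulrA -mulrDr => h; apply: (@symb_varI _ i).
by rewrite h; ring.
Qed.

Lemma log_rel_shiftX B1 B2 C :
  log_rel f B1 B2 C -> log_rel f (sx B1) (sx B2) (sx C).
Proof.
move=> /log_relP h; apply/log_relP => i j; rewrite !symb_coef_shiftX.
by case: j => [|j] //; rewrite !mderiv0 !mul0r !addr0 mul0r.
Qed.

Lemma log_rel_shiftY B1 B2 C :
  log_rel f B1 B2 C -> log_rel f (sy B1) (sy B2) (sy C).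
Proof.
by move=> /log_relP h; apply/log_relP => i j; rewrite !symb_coef_shiftY.
Qed.

Lemma log_rel_syz G :
  log_rel f (syz1 f G) (syz2 f G) (- (X1 * syz1 f G + X2 * syz2 f G)).
Proof.
rewrite /log_rel /syz1 /syz2 !symb_derivCM !symb_derivB !symb_derivXM.
by rewrite (symb_deriv_comm iy ix); ring.
Qed.

Lemma log_idealN P : log_ideal f P -> log_ideal f (- P).
Proof.
move=> [B1 [B2 [C [/log_relN h ->]]]].
by exists (- B1), (- B2), (- C); split=> //; ring.
Qed.

Lemma log_idealD P Q : log_ideal f P -> log_ideal f Q -> log_ideal f (P + Q).
Proof.
move=> [B1 [B2 [C [rel ->]]]] [B1' [B2' [C' [rel' ->]]]].
exists (B1 + B1'), (B2 + B2'), (C + C'); split; first exact: log_relD.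
by ring.
Qed.

Lemma log_idealX i P : log_ideal f P -> log_ideal f (symb_var k i * P).
Proof.
move=> [B1 [B2 [C [rel ->]]]].
exists (symb_var k i * B1), (symb_var k i * B2), (symb_var k i * C).
by split; [exact: log_relX | ring].
Qed.

Lemma log_ideal0 : log_ideal f 0.
Proof.
exists 0, 0, 0; split; last by ring.
by rewrite -(symb_const0 k); apply/log_rel_const; rewrite raddf0; ring.
Qed.

Lemma log_ideal_surj2 P : exists h P' Q, P = h%:S + (X1 * Q - X2 * P').
Proof.
exists (cf P 0 0), (- sy P), (sx P); rewrite {1}[P]symb_decomp; ring.
Qed.

(** The constant coefficients of the relation give the logarithmic form with numerators (b2, - b1),
    and h is the constant coefficient of C. *)
Lemma log_ideal_inj2 h P Q : log_ideal f (h%:S - (X1 * Q - X2 * P)) ->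
  exists a b c, b * fx - a * fy = c * f /\ h = mderiv ix b - mderiv iy a - c.
Proof.
move=> [B1 [B2 [C [/log_relP/(_ 0 0)%N rel e]]]].
have := congr1 (fun p => cf p 0 0) e.
rewrite !symb_coefE /= !(oppr0, addr0, add0r).
move=> ->; move: rel.
set b1 := cf B1 0 0; set b2 := cf B2 0 0; set c := cf C 0 0.
move=> rel; exists b2, (- b1), (- (c + mderiv ix b1 + mderiv iy b2)).
by split; [rewrite mulNr -opprD rel; ring | rewrite mderivN; ring].
Qed.

(** The constant coefficients of the relation give a logarithmic form, closed because C has constant
    coefficient 0. Moving the rest to the left yields X1 Q' = X2 P' with Q' and P' equal to Q - b
    and P - a modulo the ideal, and [symb_koszul] provides S. *)
Lemma log_ideal_surj1 P Q : log_ideal f (X1 * Q - X2 * P) -> exists a b S,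
  [/\ b * fx - a * fy = (mderiv ix b - mderiv iy a) * f,
      log_ideal f (P - a%:S - X1 * S) & log_ideal f (Q - b%:S - X2 * S)].
Proof.
move=> [B1 [B2 [C [rel e]]]].
have := congr1 (fun p => cf p 0 0) e.
rewrite !symb_coefE /= !(oppr0, addr0, add0r).
move=> C0; set a := cf B2 0 0; set b := cf B1 0 0.
(* The part of the relation beyond its constant coefficients has symbol X1 * mu sx + X2 * mu sy, and
   both values of mu lie in the ideal. *)
pose mu (s : T -> T) := X1 * s B1 + X2 * s B2 + s C.
have [|S [QS PS]] := @symb_koszul k (Q - b%:S - mu sx) (P + a%:S + mu sy).
  apply/eqP; rewrite -subr_eq0; apply/eqP.
  transitivity ((X1 * Q - X2 * P) - (X1 * B1 + X2 * B2 + C)); last first.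
    by rewrite e subrr.
  rewrite [B1 in RHS]symb_decomp [B2 in RHS]symb_decomp.
  rewrite [C in RHS]symb_decomp -C0.
  by rewrite /mu -/a -/b symb_const0; ring.
exists (- a), b, S; split.
- have := (log_relP _ _ _).1 rel 0%N 0%N; rewrite -C0 -/a -/b mderivN => h.
  by rewrite mulNr opprK h; ring.
- rewrite -PS symb_constN (_ : _ - _ = - mu sy); last by ring.
  apply: log_idealN; exists (sy B1), (sy B2), (sy C); split=> //.
  exact: log_rel_shiftY.
- rewrite -QS (_ : _ - _ = mu sx); last by ring.
  by exists (sx B1), (sx B2), (sx C); split=> //; exact: log_rel_shiftX.
Qed.

(** X1 (b - X2 S) - X2 (a - X1 S) does not involve S and equals X1 b - X2 a, which also has the
    relation (b, - a, 0) because the form is closed. The difference of the two relations is a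
    syzygy; its constant coefficients give a and b. *)
Lemma log_ideal_inj1 a b S :
  b * fx - a * fy = (mderiv ix b - mderiv iy a) * f ->
  log_ideal f (a%:S - X1 * S) -> log_ideal f (b%:S - X2 * S) ->
  exists g, a = f * mderiv ix g /\ b = f * mderiv iy g.
Proof.
move=> ab [M1 [M2 [M3 [relM eM]]]] [N1 [N2 [N3 [relN eN]]]].
have rel0 : log_rel f b%:S (- a%:S) 0.
  rewrite -symb_constN -(symb_const0 k); apply/log_rel_const.
  by rewrite mderivN add0r mulNr ab.
have := log_relB (log_relB (log_relX ix relN) (log_relX iy relM)) rel0.
case/(syzygy f0 f_sqf).
  transitivity (X1 * (X1 * N1 + X2 * N2 + N3) - X2 * (X1 * M1 + X2 * M2 + M3)
    - (X1 * b%:S - X2 * a%:S)); first by ring.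
  by rewrite -eM -eN; ring.
move=> G [/(congr1 (fun p => cf p 0 0)) e1 /(congr1 (fun p => cf p 0 0)) e2].
move: e1 e2; rewrite !symb_coefE /= oppr0 !opprK !add0r !addr0 => e1 e2.
exists (- cf G 0 0); rewrite !mderivN !mulrN; split; first by rewrite e2 mulrN.
by rewrite -e1 opprK.
Qed.

(** As g is constant, X1 f g and X2 f g have the relations (f g, 0, 0) and (0, f g, 0). Comparison
    with X1 and X2 times the given relation for f g produces two syzygies G1 and G2. *)
Lemma log_ideal_inj0 g : mderiv ix g = 0 -> mderiv iy g = 0 ->
  log_ideal f (f * g)%:S -> g = 0.
Proof.
move=> gx gy [B1 [B2 [C [rel e]]]].
have rel1 : log_rel f (f * g)%:S 0 0.
  rewrite -(symb_const0 k); apply/log_rel_const.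
  by rewrite mderivM gx raddf0; ring.
have rel2 : log_rel f 0 (f * g)%:S 0.
  rewrite -(symb_const0 k); apply/log_rel_const.
  by rewrite mderivM gy raddf0; ring.
have [|G1 [e1 _]] := syzygy f0 f_sqf (log_relB (log_relX ix rel) rel1).
  transitivity (X1 * ((X1 * B1 + X2 * B2 + C) - (f * g)%:S)); first by ring.
  by rewrite e subrr mulr0.
have [|G2 [e2 _]] := syzygy f0 f_sqf (log_relB (log_relX iy rel) rel2).
  transitivity (X2 * ((X1 * B1 + X2 * B2 + C) - (f * g)%:S)); first by ring.
  by rewrite e subrr mulr0.
(* Eliminating B1 between the first components of the two syzygies gives this equation; the symbol
   that it kills has constant coefficient g. *)
have /symb_var_deriv_eq0 H0 : X2 * (X1 * G2 - X2 * G1 + g%:S) =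
    D iy (X1 * G2 - X2 * G1 + g%:S).
  apply: (symb_const_mulI f0); apply: subr0_eq.
  rewrite symb_derivD symb_derivB !symb_derivXM symb_derivC gy symb_const0 addr0.
  transitivity (X2 * (f * g)%:S + X2 * syz1 f G1 - X1 * syz1 f G2).
    by rewrite symb_constM /syz1; ring.
  by rewrite -e1 -e2; ring.
have := congr1 (fun p => cf p 0 0) H0.
by rewrite symb_coef0 !symb_coefE /= oppr0 !add0r.
Qed.

(** From X2 (X1 P) = X1 (X2 P) one gets a syzygy G. Its constant coefficient g has zero derivatives,
    and P + f g is shown to lie in the ideal by cancelling X1 in a corrected relation for X1 P. *)
Lemma log_ideal_surj0 P : log_ideal f (X1 * P) -> log_ideal f (X2 * P) ->
  exists c : k, log_ideal f (P - (c *: f)%:S).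
Proof.
move=> [M1 [M2 [M3 [relM eM]]]] [N1 [N2 [N3 [relN eN]]]].
have := log_relB (log_relX iy relM) (log_relX ix relN).
case/(syzygy f0 f_sqf).
  transitivity (X2 * (X1 * M1 + X2 * M2 + M3) - X1 * (X1 * N1 + X2 * N2 + N3)).
    by ring.
  by rewrite -eM -eN; ring.
move=> G [e1 e2]; set g := cf G 0 0.
have := congr1 (fun p => cf p 0 0) e1; have := congr1 (fun p => cf p 0 0) e2.
rewrite /syz1 /syz2 !symb_coefE /= !oppr0 !add0r !addr0 -/g => gx gy.
have gC : g = (g@_0%MM)%:MP.
  apply: mderiv_eq0_const; apply: ord2P; apply: (mulfI f0); rewrite mulr0 //.
  by apply: oppr_inj; rewrite -mulrN -gx oppr0.
have [gx0 gy0] : mderiv ix g = 0 /\ mderiv iy g = 0 by rewrite gC !mderivC.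
move: gC; set c := _@_ _ => gC.
(* As g is constant, its own syzygy is (- X2 f g, X1 f g). *)
have e1' : syz1 f G = X1 * syz1 f (sx G) + X2 * syz1 f (sy G) - X2 * (f * g)%:S.
  rewrite {1}[G]symb_decomp -/g /syz1 !symb_derivD !symb_derivXM symb_derivC gy0.
  by rewrite symb_const0 symb_constM; ring.
have e2' : syz2 f G = X1 * syz2 f (sx G) + X2 * syz2 f (sy G) + X1 * (f * g)%:S.
  rewrite {1}[G]symb_decomp -/g /syz2 !symb_derivD !symb_derivXM symb_derivC gx0.
  by rewrite symb_const0 symb_constM; ring.
have rel1 : log_rel f (f * g)%:S 0 0.
  rewrite -(symb_const0 k); apply/log_rel_const.
  by rewrite mderivM gx0 raddf0; ring.
have [|S1 [_ S1E]] :=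
    @symb_koszul k (N1 + syz1 f (sx G)) (M1 - syz1 f (sy G) + (f * g)%:S).
  apply: subr0_eq; transitivity (syz1 f G - (X2 * M1 - X1 * N1)).
    by rewrite e1'; ring.
  by rewrite e1 subrr.
have [|S2 [_ S2E]] :=
    @symb_koszul k (N2 + syz2 f (sx G) + (f * g)%:S) (M2 - syz2 f (sy G)).
  apply: subr0_eq; transitivity (syz2 f G - (X2 * M2 - X1 * N2)).
    by rewrite e2'; ring.
  by rewrite e2 subrr.
(* The relation for X1 P, minus the syzygy of [sy G], plus (f g, 0, 0), has first two components X1
   S1 and X1 S2 and symbol X1 (P + f g). *)
exists (- c); exists S1, S2, (P + (f * g)%:S - X1 * S1 - X2 * S2); split; last first.
  rewrite gC (_ : (_ *: f) = - (f * c%:MP)) ?symb_constN; first by ring.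
  by rewrite scaleNr -mul_mpolyC mulrC.
apply: (@log_relXI ix).
have := log_relD (log_relB relM (log_rel_syz (sy G))) rel1.
rewrite S1E !addr0 S2E; congr (log_rel f _ _ _).
transitivity (X1 * P + X1 * (f * g)%:S - X1 * (X1 * S1) - X2 * (X1 * S2));
  last by ring.
by rewrite -S1E -S2E eM; ring.
Qed.

End LogCohomology.

(** * Quantization of symbols *)

Section SkewEval.
Variables (S W : nzRingType) (d : W) (e : {additive S -> W}).

Definition skew_eval (p : {poly S}) : W := \sum_(i < size p) d ^+ i * e p`_i.

Lemma skew_evalE n (p : {poly S}) : (size p <= n)%N ->
  skew_eval p = \sum_(i < n) d ^+ i * e p`_i.
Proof.
move=> pn; rewrite /skew_eval (big_ord_widen n (fun i => d ^+ i * e p`_i) pn).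
rewrite big_mkcond; apply: eq_bigr => i _; case: ltnP => // pi.
by rewrite nth_default // raddf0 mulr0.
Qed.

Lemma skew_eval_is_zmod_morphism : zmod_morphism skew_eval.
Proof.
move=> p q; pose n := maxn (size p) (size q).
have pn : (size p <= n)%N by rewrite leq_maxl.
have qn : (size q <= n)%N by rewrite leq_maxr.
have pqn : (size (p - q)%R <= n)%N.
  by apply: leq_trans (size_polyD _ _) _; rewrite size_polyN.
rewrite !(@skew_evalE n) // -sumrB; apply: eq_bigr => i _.
by rewrite coefB raddfB mulrBr.
Qed.
HB.instance Definition _ :=
  GRing.isZmodMorphism.Build {poly S} W skew_eval skew_eval_is_zmod_morphism.

Lemma skew_evalC c : skew_eval c%:P = e c.
Proof.
by rewrite (@skew_evalE 1) ?size_polyC_leq1 // big_ord1 coefC expr0 mul1r.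
Qed.

Lemma skew_evalXM p : skew_eval (p * 'X) = d * skew_eval p.
Proof.
rewrite (@skew_evalE (size p).+1); last first.
  by apply: leq_trans (size_polyMleq _ _) _; rewrite size_polyX addn2.
rewrite big_ord_recl coefMX raddf0 mulr0 add0r mulr_sumr.
by apply: eq_bigr => i _; rewrite coefMX exprS mulrA.
Qed.

Lemma skew_evalCM c w p : GRing.comm w d -> (forall s, e (c * s) = w * e s) ->
  skew_eval (c%:P * p) = w * skew_eval p.
Proof.
move=> wd we; rewrite (@skew_evalE (size p)); last first.
  apply: leq_trans (size_polyMleq _ _) _; have := size_polyC_leq1 c.
  by case: (size c%:P) => [|[|//]] _; rewrite ?leq_pred.
rewrite mulr_sumr; apply: eq_bigr => i _.
by rewrite coefCM we !mulrA (commrX i wd).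
Qed.

Lemma skew_eval_comm y p : GRing.comm y d -> (forall s, GRing.comm y (e s)) ->
  GRing.comm y (skew_eval p).
Proof.
move=> yd ye; apply: commr_sum => i _.
by apply: commrM => //; exact: commrX.
Qed.

Section Injective.
Variable x : W.
Hypotheses (dx : d * x - x * d = 1) (xe : forall s, GRing.comm x (e s)).

Lemma skew_eval_deriv p : skew_eval p * x - x * skew_eval p = skew_eval p^`().
Proof.
elim/poly_ind: p => [|p c ih]; first by rewrite deriv0 !raddf0 mul0r mulr0 subr0.
rewrite derivMXaddC raddfD /= skew_evalXM skew_evalC raddfD /= skew_evalXM -ih.
have -> : x * (d * skew_eval p + e c) = e c * x + x * d * skew_eval p.
  by rewrite mulrDr mulrA xe addrC.
have -> : x * d = d * x - 1 by rewrite -dx opprB addrC subrK.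
by rewrite mulrDl mulrBl mul1r mulrBr !mulrA addrKA opprB addrCA.
Qed.

(** The commutator with x sends the value at p to the value at p'. So if p is in the kernel, then p'
    = 0 by induction on the size, p is constant in characteristic 0, and e is injective. *)
Lemma skew_eval_inj : injective e ->
  (forall (s : S) n, s *+ n.+1 = 0 -> s = 0) -> injective skew_eval.
Proof.
move=> e_inj char0; apply: raddf_inj => p.
elim: {p}_.+1 {-2}p (ltnSn (size p)) => // n IHn p pn p0.
have [->//|pnz] := eqVneq p 0.
have dp0 : p^`() = 0.
  apply: IHn; first exact: leq_trans (lt_size_deriv pnz) _.
  transitivity (skew_eval p * x - x * skew_eval p).
    by rewrite skew_eval_deriv.
  by rewrite [skew_eval p]p0 mul0r mulr0 subrr.
have pC : p = (p`_0)%:P.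
  apply/polyP => -[|i]; rewrite coefC //=; apply: (char0 _ i).
  by rewrite -coef_deriv dp0 coef0.
by rewrite pC (e_inj p`_0 0) ?raddf0 // -skew_evalC -pC.
Qed.

End Injective.
End SkewEval.

Section Weyl.
Variable k : numClosedFieldType.
Notation R := {mpoly k[2]}.
Local Notation T := {poly {poly R}}.
Local Notation A := (weyl k).
Local Notation X1 := (symb_var k ix).
Local Notation X2 := (symb_var k iy).

Fact opM_is_zmod_morphism : zmod_morphism (@opM k).
Proof. by move=> r s; apply: weylE => p /=; rewrite mulrBl. Qed.
HB.instance Definition _ :=
  GRing.isZmodMorphism.Build R A (@opM k) opM_is_zmod_morphism.

Lemma opMM r s : opM (r * s) = opM r * opM s :> A.
Proof. by apply: weylE => p; rewrite weylME /= mulrA. Qed.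

Lemma opM_inj : injective (@opM k).
Proof.
by move=> r s /(congr1 (fun P : A => P 1)) /=; rewrite !mulr1.
Qed.

Lemma opM_comm r s : GRing.comm (opM r : A) (opM s).
Proof. by rewrite /GRing.comm -!opMM mulrC. Qed.

Lemma opD_comm i j : GRing.comm (opD k i) (opD k j).
Proof. by apply: weylE => p; rewrite !weylME /= mderiv_comm. Qed.

Lemma opDM i r : opD k i * opM r = opM r * opD k i + opM (mderiv i r).
Proof. by apply: weylE => p; rewrite weylDE !weylME /= mderivM addrC. Qed.

Lemma opDX i j : opD k i * opM 'X_j - opM 'X_j * opD k i = (i == j)%:R.
Proof.
rewrite opDM addrAC subrr add0r mderivX mnmE eq_sym; case: eqP => [->|_].
  rewrite scale1r (_ : (_ - _)%MM = 0%MM); last first.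
    by apply/mnmP => l; rewrite !mnmE subnn.
  rewrite mpolyX0.
  by apply: weylE => p; rewrite /= mul1r; exact/esym/scale1r.
by rewrite scale0r raddf0.
Qed.

End Weyl.

(* The normal ordering with the derivations on the left: [quantize] sends     *)
(* X1^i X2^j r to d_2^j d_1^i r.                                              *)
Definition quantize_inner (k : numClosedFieldType) :
    {poly {mpoly k[2]}} -> weyl k :=
  skew_eval (opD k ix) (@opM k).
HB.instance Definition _ k := GRing.Additive.copy (@quantize_inner k)
  (skew_eval (opD k ix) (@opM k)).
HB.lock Definition quantize (k : numClosedFieldType)
    (p : {poly {poly {mpoly k[2]}}}) : weyl k :=
  skew_eval (opD k iy) (@quantize_inner k) p.

Section Quantization.
Variable k : numClosedFieldType.
Notation R := {mpoly k[2]}.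
Local Notation T := {poly {poly R}}.
Local Notation A := (weyl k).
Local Notation X1 := (symb_var k ix).
Local Notation X2 := (symb_var k iy).

Fact quantize_is_zmod_morphism : zmod_morphism (@quantize k).
Proof. by move=> p q; rewrite quantize.unlock raddfB. Qed.
HB.instance Definition _ :=
  GRing.isZmodMorphism.Build T A (@quantize k) quantize_is_zmod_morphism.

Implicit Types (p q : T) (r s : R) (P : A).

Lemma quantizeD p q : quantize (p + q) = quantize p + quantize q.
Proof. exact: raddfD. Qed.
Lemma quantizeB p q : quantize (p - q) = quantize p - quantize q.
Proof. exact: raddfB. Qed.

Lemma quantizeC r : quantize r%:S = opM r.
Proof.
by rewrite quantize.unlock symb_const.unlock skew_evalC; exact: skew_evalC.
Qed.

Lemma quantizeX i p : quantize (symb_var k i * p) = opD k i * quantize p.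
Proof.
rewrite quantize.unlock symb_var.unlock; elim/ord2P: i => /=.
  apply: skew_evalCM => [|q]; first exact: opD_comm.
  by rewrite mulrC /= /quantize_inner skew_evalXM.
by rewrite mulrC skew_evalXM.
Qed.

Lemma quantize_inj : injective (@quantize k).
Proof.
have comm_opDM : GRing.comm (opM 'X_iy : A) (opD k ix).
  by apply/esym/eqP; rewrite -subr_eq0 opDX.
have mulrn_eq0' (r : R) n : r *+ n.+1 = 0 -> r = 0.
  rewrite -mulr_natl -mpolyC_nat mul_mpolyC => /eqP.
  by rewrite mscalerI pnatr_eq0 => /eqP.
move=> p q; rewrite quantize.unlock.
apply: (@skew_eval_inj _ _ _ _ (opM 'X_iy)).
- exact: opDX.
- by move=> s; apply: skew_eval_comm => // r; exact: opM_comm.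
- apply: (@skew_eval_inj _ _ _ _ (opM 'X_ix)).
  + exact: opDX.
  + by move=> r; exact: opM_comm.
  + exact: opM_inj.
  + exact: mulrn_eq0'.
- move=> s n sn; apply/polyP => i; rewrite coef0; apply: (mulrn_eq0' _ n).
  by rewrite -coefMn sn coef0.
Qed.

Lemma symb_ind (P : T -> Prop) : (forall r, P r%:S) ->
  (forall p q, P p -> P q -> P (p + q)) ->
  (forall i p, P p -> P (symb_var k i * p)) -> forall p, P p.
Proof.
rewrite symb_const.unlock symb_var.unlock => PC PD PX.
elim/poly_ind => [|p q Pp]; first by rewrite -!polyC0; exact: (PC).
apply: (PD); first by rewrite mulrC; exact: (PX iy).
elim/poly_ind: q => [|q r Pq]; first exact: (PC).
by rewrite polyCD polyCM mulrC; apply: (PD); [exact: (PX ix) | exact: (PC)].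
Qed.

(** Multiplication by r is moved to the right through r d_i = d_i r - d_i(r). *)
Lemma quantize_mulM r p : exists q, opM r * quantize p = quantize q.
Proof.
elim/symb_ind: p r => [s|p q IHp IHq|i p IHp] r.
- by exists (r * s)%:S; rewrite !quantizeC opMM.
- have [p' p'E] := IHp r; have [q' q'E] := IHq r.
  by exists (p' + q'); rewrite !quantizeD mulrDr p'E q'E.
- have [p' p'E] := IHp r; have [q q'E] := IHp (mderiv i r).
  exists (symb_var k i * p' - q); rewrite quantizeB !quantizeX -p'E -q'E.
  by rewrite !mulrA opDM mulrDl addrK.
Qed.

(** The image of [quantize] is stable under left composition with the generators of A_2 and contains
    1. *)
Lemma quantize_surj P : exists p, P = quantize p.
Proof.
have h (Q : R -> R) : is_diffop Q -> forall p, exists q, forall g,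
    Q (quantize p g) = quantize q g.
  elim=> [c|i|i|Q1 Q2 _ IH1 _ IH2|Q1 Q2 _ IH1 _ IH2] p.
  - have [q qE] := quantize_mulM c%:MP p; exists q => g.
    by rewrite -qE weylME /= mul_mpolyC.
  - by have [q qE] := quantize_mulM 'X_i p; exists q => g; rewrite -qE weylME.
  - by exists (symb_var k i * p) => g; rewrite quantizeX weylME.
  - have [q1 q1E] := IH1 p; have [q2 q2E] := IH2 p.
    by exists (q1 + q2) => g; rewrite quantizeD weylDE q1E q2E.
  - have [q2 q2E] := IH2 p; have [q1 q1E] := IH1 q2.
    by exists q1 => g; rewrite q2E q1E.
have [p pE] := h P (weyl_diffop P) 1%:S; exists p; apply: weylE => g.
by rewrite -pE quantizeC /= mul1r.
Qed.

Variable f : R.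
Local Notation cf := symb_coef.
Local Notation I := (left_ideal (twisted_log_der f)).

Lemma big_ord2 (V : nmodType) (F : 'I_2 -> V) : \sum_i F i = F ix + F iy.
Proof.
by rewrite big_ord_recl big_ord1; congr (_ + F _); apply: val_inj.
Qed.

Lemma quantize_derivation (a : 'I_2 -> R) c :
  quantize (X1 * (a ix)%:S + X2 * (a iy)%:S + c%:S) =
  \sum_i opM (a i) * opD k i + opM (c + mderiv ix (a ix) + mderiv iy (a iy)).
Proof.
rewrite !quantizeD !quantizeX !quantizeC !opDM big_ord2 !raddfD /=.
by rewrite addrACA -[LHS]addrA; congr (_ + _); rewrite addrC addrA.
Qed.

Lemma twisted_log_derP P : twisted_log_der f P <->
  exists a b c, log_rel f a%:S b%:S c%:S /\
    P = quantize (X1 * a%:S + X2 * b%:S + c%:S).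
Proof.
split=> [[a [h [hf ->]]]|[a [b [c [/log_rel_const rel ->]]]]].
  set ax := mderiv ix (a ix); set ay := mderiv iy (a iy).
  have hE : h - ax - ay + ax + ay = h by ring.
  exists (a ix), (a iy), (h - ax - ay); split.
    by apply/log_rel_const; rewrite hE -hf /derivation big_ord2.
  by rewrite quantize_derivation hE.
exists (fun i => if i == ix then a else b), (c + mderiv ix a + mderiv iy b).
rewrite -rel /derivation big_ord2; split=> //.
exact: (quantize_derivation (fun i => if i == ix then a else b)).
Qed.

(** Stability under R means that, in the left ideal, only left multiplications by d_1 and d_2 remain
    to be followed on symbols. *)
Lemma twisted_log_der_mulM r P :
  twisted_log_der f P -> twisted_log_der f (opM r * P).
Proof.
move=> [a [h [hf ->]]]; exists (fun i => r * a i), (r * h); split.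
  rewrite -mulrA -hf /derivation mulr_sumr; apply: eq_bigr => i _.
  by rewrite mulrA.
rewrite mulrDr opMM mulr_sumr; congr (_ + _); apply: eq_bigr => i _.
by rewrite opMM mulrA.
Qed.

Lemma quantize_log_ideal p : quantize p \in I -> log_ideal f p.
Proof.
have idealM u P : twisted_log_der f P ->
    exists q, log_ideal f q /\ quantize u * P = quantize q.
  move=> PT; elim/symb_ind: u => [r|u v [p' [Ip pE]] [q [Iq qE]]|i u [q [Iq qE]]].
  - have /twisted_log_derP[a [b [c [rel e]]]] := twisted_log_der_mulM r PT.
    exists (X1 * a%:S + X2 * b%:S + c%:S); split; last by rewrite quantizeC.
    by exists a%:S, b%:S, c%:S.
  - exists (p' + q); split; last by rewrite !quantizeD mulrDl pE qE.
    exact: log_idealD.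
  - exists (symb_var k i * q); split; last by rewrite !quantizeX -mulrA qE.
    exact: log_idealX.
rewrite unfold_in => /asboolP[s [sT e]].
suff [q [Iq qE]] : exists q,
    log_ideal f q /\ \sum_(r <- s) r.1 * r.2 = quantize q.
  by rewrite (quantize_inj (etrans e qE)).
elim: s sT {e} => [|r s IHs] sT.
  exists 0; rewrite big_nil raddf0; split=> //; exact: log_ideal0.
have [|q [Iq qE]] := IHs; first by move=> t ts; apply: sT; rewrite inE ts orbT.
have [u uE] := quantize_surj r.1.
have [|q' [Iq' q'E]] := idealM u r.2; first by apply: sT; rewrite inE eqxx.
exists (q' + q); rewrite big_cons uE q'E qE quantizeD; split=> //.
exact: log_idealD.
Qed.

(** Induction on the degree of the relation: its constant coefficients quantize to a generator, and
    the rest is X1 and X2 times the shifted relations, of lower degree. *)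
Lemma log_ideal_quantize p : log_ideal f p -> quantize p \in I.
Proof.
move=> [B1 [B2 [C [rel ->]]]].
have [n1 h1] := symb_degree B1; have [n2 h2] := symb_degree B2.
have [n3 h3] := symb_degree C; pose n := maxn n1 (maxn n2 n3).
have {h1} : forall i j, (n <= i + j)%N -> cf B1 i j = 0.
  by move=> i j ij; apply: h1; apply: leq_trans ij; rewrite /n; lia.
have {h2} : forall i j, (n <= i + j)%N -> cf B2 i j = 0.
  by move=> i j ij; apply: h2; apply: leq_trans ij; rewrite /n; lia.
have {h3} : forall i j, (n <= i + j)%N -> cf C i j = 0.
  by move=> i j ij; apply: h3; apply: leq_trans ij; rewrite /n; lia.
clearbody n; elim: n B1 B2 C rel {n1 n2 n3} => [|n IHn] B1 B2 C rel h3 h2 h1.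
  have z (B : T) : (forall i j, (0 <= i + j)%N -> cf B i j = 0) -> B = 0.
    by move=> h; apply: symb_coefP => i j; rewrite h // symb_coef0.
  by rewrite (z B1) // (z B2) // (z C) // !mulr0 !addr0 raddf0 rpred0.
have shX (B : T) : (forall i j, (n.+1 <= i + j)%N -> cf B i j = 0) ->
    forall i j, (n <= i + j)%N -> cf (symb_shiftX B) i j = 0.
  move=> h i [|j] ij; rewrite symb_coef_shiftX // h //.
have shY (B : T) : (forall i j, (n.+1 <= i + j)%N -> cf B i j = 0) ->
    forall i j, (n <= i + j)%N -> cf (symb_shiftY B) i j = 0.
  by move=> h i j ij; rewrite symb_coef_shiftY h // addnS.
have -> : X1 * B1 + X2 * B2 + C =
   (X1 * (cf B1 0 0)%:S + X2 * (cf B2 0 0)%:S + (cf C 0 0)%:S)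
   + X1 * (X1 * symb_shiftX B1 + X2 * symb_shiftX B2 + symb_shiftX C)
   + X2 * (X1 * symb_shiftY B1 + X2 * symb_shiftY B2 + symb_shiftY C).
  by rewrite {1}[B1]symb_decomp {1}[B2]symb_decomp {1}[C]symb_decomp; ring.
rewrite [quantize _]quantizeD [quantize (_ + X1 * _)]quantizeD !quantizeX.
apply: rpredD; first apply: rpredD.
- rewrite unfold_in; apply/asboolP; exists [:: (1, quantize
    (X1 * (cf B1 0 0)%:S + X2 * (cf B2 0 0)%:S + (cf C 0 0)%:S))].
  rewrite big_seq1 mul1r; split=> // q; rewrite inE => /eqP -> /=.
  apply/twisted_log_derP; exists (cf B1 0 0), (cf B2 0 0), (cf C 0 0); split=> //.
  by apply/log_rel_const; have /log_relP := rel; apply.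
- apply: (@rpredZ _ _ I (opD k ix)); apply: IHn; try exact: shX.
  exact: log_rel_shiftX.
- apply: (@rpredZ _ _ I (opD k iy)); apply: IHn; try exact: shY.
  exact: log_rel_shiftY.
Qed.

End Quantization.

(** * The comparison morphism *)

Section CohomologyCriterion.
Variables (k : fieldType) (X Y : cochain k) (phi : cochain_hom X Y) (p : nat).

Lemma cohomology_map_bij :
  (forall x : X p, cdiff X p x = 0 ->
     is_coboundary (phi p x) -> is_coboundary x) ->
  (forall y : Y p, cdiff Y p y = 0 ->
     exists x : X p, cdiff X p x = 0 /\ is_coboundary (y - phi p x)) ->
  bijective (@cohomology_map k X Y phi p).
Proof.
move=> inj surj; have h_inj : injective (@cohomology_map k X Y phi p).
  move=> c c'; have [z ->] := quotpi_surj c; have [z' ->] := quotpi_surj c'.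
  rewrite !cohomology_mapE => /quotpiP; rewrite unfold_in => /asboolP h.
  apply/quotpiP; rewrite unfold_in; apply/asboolP; apply: inj.
    by apply/eqP; exact: (valP (z - z')).
  by move: h; rewrite !linearB.
have /choice[g gK] : forall y, exists x, @cohomology_map k X Y phi p x = y.
  move=> c; have [y ->] := quotpi_surj c.
  have [|x [dx xy]] := surj (val y); first by apply/eqP; exact: (valP y).
  have zx : x \in @cocycle k X p by rewrite unfold_in dx.
  exists (quotpi _ (Submodule zx)); rewrite cohomology_mapE; apply/esym/quotpiP.
  by rewrite unfold_in; apply/asboolP; rewrite linearB.
by exists g => // c; apply: h_inj; rewrite gK.
Qed.

End CohomologyCriterion.

(** * Explicit description of logarithmic forms *)

Section LogForms.
Variables (k : numClosedFieldType) (f : {mpoly k[2]}).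
Hypotheses (f0 : f != 0) (f_sqf : square_free f).
Notation R := {mpoly k[2]}.
Local Notation ratfun := (ratfun k).
Local Notation inj := (@inj_frac k).
Local Notation fx := (mderiv ix f).
Local Notation fy := (mderiv iy f).
Implicit Types (a b c g h r s : R) (q : ratfun).

Lemma inj_frac_inj : injective inj.
Proof.
move=> r s /eqP; rewrite -subr_eq0 -rmorphB inj_frac_eq0 subr_eq0.
by move/eqP.
Qed.

Lemma inj_fracM r s : inj (r * s) = inj r * inj s.
Proof. exact: rmorphM. Qed.
Lemma inj_fracB r s : inj (r - s) = inj r - inj s.
Proof. exact: rmorphB. Qed.

Let F0 : inj f != 0. Proof. by rewrite inj_frac_eq0. Qed.

Lemma mulf_divf r : inj f * (inj r / inj f) = inj r.
Proof. by rewrite mulrC divfK. Qed.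

Lemma mulf_eq r q : inj f * q = inj r -> q = inj r / inj f.
Proof. by move=> <-; rewrite mulrC mulKf. Qed.

Lemma ratderiv_divf i r : ratderiv i (inj r / inj f) =
  inj (mderiv i r * f - r * mderiv i f) / inj f / inj f.
Proof. by rewrite ratderivE // expr2 inj_fracM invfM mulrA. Qed.

Definition divf_form a b : dRform ratfun 1 := (inj a / inj f, inj b / inj f).

(** The quotient rule produces the denominator f^2, and the logarithmic condition cancels one factor
    f. *)
Lemma dform_divf_form a b c : b * fx - a * fy = c * f ->
  dform (@ratderiv k) (divf_form a b) =
  inj (mderiv ix b - mderiv iy a - c) / inj f.
Proof.
move=> e; rewrite /= !ratderiv_divf -!mulrBl -inj_fracB; congr (_ / _).
apply: (mulIf F0); rewrite divfK // -inj_fracM; congr (inj _).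
by rewrite !mulrBl -e; ring.
Qed.

(** If w = r / f, polynomiality of f dw says that f divides r f_x and r f_y, hence r. *)
Lemma log_form0P (w : dRform ratfun 0) :
  w \in @log_form k f 0 <-> exists g, w = inj g.
Proof.
rewrite unfold_in; split=> [/asboolP[_ [r rE] [s sE]]|[g ->]].
  have rE' := mulf_eq (esym rE).
  have h i s' : inj s' = inj f * ratderiv i w -> divides f (r * mderiv i f).
    rewrite rE' ratderiv_divf mulrC divfK // => e; exists (mderiv i r - s').
    have /inj_frac_inj e' :
        inj (s' * f) = inj (mderiv i r * f - r * mderiv i f).
      by rewrite inj_fracM e divfK.
    by rewrite mulrBr [f * s']mulrC e'; ring.
  have [|t tE] := square_free_divides f0 f_sqf (g := r).
    apply: ord2P; [apply: (h _ s.1) | apply: (h _ s.2)].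
      exact: (congr1 fst sE).
    exact: (congr1 snd sE).
  by exists t; rewrite rE' tE inj_fracM mulrC mulKf.
apply/asboolP; split.
- by exists g, 0%N; rewrite expr0 divr1.
- by exists (f * g); rewrite /= /mul_by_f -inj_fracM.
- exists (f * mderiv ix g, f * mderiv iy g).
  by rewrite /= /mul_by_f !ratderiv_frac -!inj_fracM.
Qed.

Lemma log_form1P (w : dRform ratfun 1) :
  w \in @log_form k f 1 <->
  exists a b c, w = divf_form a b /\ b * fx - a * fy = c * f.
Proof.
rewrite unfold_in; split=> [/asboolP[_ [u uE] [h hE]]|[a [b [c [-> e]]]]].
  have w1 : w.1 = inj u.1 / inj f := mulf_eq (esym (congr1 fst uE)).
  have w2 : w.2 = inj u.2 / inj f := mulf_eq (esym (congr1 snd uE)).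
  exists u.1, u.2, (mderiv ix u.2 - mderiv iy u.1 - h); split.
    by rewrite /divf_form -w1 -w2; case: (w).
  have {}hE : inj h = inj f * (ratderiv ix w.2 - ratderiv iy w.1) := hE.
  move: hE; rewrite w1 w2 !ratderiv_divf -!mulrBl mulrC divfK // -inj_fracB.
  move=> hE.
  have /inj_frac_inj e : inj (h * f) = inj (mderiv ix u.2 * f - u.2 * fx -
      (mderiv iy u.1 * f - u.1 * fy)) by rewrite inj_fracM hE divfK.
  by rewrite !mulrBl e; ring.
apply/asboolP; split.
- by split; [exists a, 1%N | exists b, 1%N]; rewrite expr1.
- by exists (a, b); rewrite /= /mul_by_f !mulf_divf.
- exists (mderiv ix b - mderiv iy a - c).
  by rewrite (dform_divf_form e) /= /mul_by_f mulf_divf.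
Qed.

Lemma log_form2P (w : dRform ratfun 2) :
  w \in @log_form k f 2 <-> exists h, w = inj h / inj f.
Proof.
rewrite unfold_in; split=> [/asboolP[_ [h hE] _]|[h ->]].
  by exists h; exact: (mulf_eq (esym hE)).
apply/asboolP; split.
- by exists h, 1%N; rewrite expr1.
- by exists h; rewrite /= /mul_by_f mulf_divf.
- by exists 0.
Qed.

Lemma form_map_inj_frac_inj p : injective (@form_map k R ratfun inj p).
Proof.
case: p => [|[|[|p]]] /=; try exact: inj_frac_inj.
- by move=> [a b] [a' b'] [/inj_frac_inj -> /inj_frac_inj ->].
- by move=> u v _; apply/rowP => -[].
Qed.

Lemma log_complex_poly p (w : log_complex f p) :
  exists eta, form_map inj eta = mulf_form f (log_val w).
Proof. by have := submodule_valP w; rewrite unfold_in => /asboolP[]. Qed.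

(** The numerator exists by logarithmicity and is extracted by choice; [numeratorE] shows that it is
    unique. *)
Definition numerator p (w : log_complex f p) : dRform R p :=
  projT1 (cid (log_complex_poly w)).

Lemma numeratorE p (w : log_complex f p) eta :
  mulf_form f (log_val w) = form_map inj eta -> numerator w = eta.
Proof.
move=> e; apply: form_map_inj_frac_inj; rewrite -e.
exact: (projT2 (cid (log_complex_poly w))).
Qed.

Lemma numeratorP p (w : log_complex f p) :
  mulf_form f (log_val w) = form_map inj (numerator w).
Proof. exact/esym/(projT2 (cid (log_complex_poly w))). Qed.

Lemma numerator_is_linear p : linear (@numerator p).
Proof.
move=> a v w; apply: numeratorE.
rewrite (form_map_linear inj) -!numeratorP.
exact: (form_map_linear (mul_by_f f)).
Qed.

End LogForms.

(** * The comparison morphism is a quasi-isomorphism *)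

Section Comparison.
Variables (k : numClosedFieldType) (f : {mpoly k[2]}).
Hypotheses (f0 : f != 0) (f_sqf : square_free f).
Notation R := {mpoly k[2]}.
Local Notation T := {poly {poly R}}.
Local Notation inj := (@inj_frac k).
Local Notation X1 := (symb_var k ix).
Local Notation X2 := (symb_var k iy).
Local Notation fx := (mderiv ix f).
Local Notation fy := (mderiv iy f).
Local Notation M := (over_field (Mlog f)).
Local Notation I := (left_ideal (twisted_log_der f)).
Implicit Types (a b c g h r s : R) (p q : T).

Definition Mlog_symb p : M := quotpi I (quantize p).

Lemma Mlog_symb_eq p q : Mlog_symb p = Mlog_symb q <-> log_ideal f (p - q).
Proof.
split=> [/quotpiP|h].
  by move=> h; apply: quantize_log_ideal; rewrite quantizeB.
by apply/quotpiP; have := log_ideal_quantize h; rewrite quantizeB.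
Qed.

Lemma Mlog_symb_surj (m : M) : exists p, m = Mlog_symb p.
Proof.
have [P ->] := quotpi_surj (m : Mlog f); have [p ->] := quantize_surj P.
by exists p.
Qed.

Lemma Mlog_symbB p q : Mlog_symb (p - q) = Mlog_symb p - Mlog_symb q.
Proof. by rewrite /Mlog_symb quantizeB; exact: linearB. Qed.
Lemma Mlog_symb_eq0 p : Mlog_symb p = 0 <-> log_ideal f p.
Proof.
rewrite -[p in log_ideal f p]subr0 -Mlog_symb_eq.
by rewrite (_ : Mlog_symb 0 = 0) // /Mlog_symb raddf0; exact: linear0.
Qed.

Lemma actD_symb i p : actD i (Mlog_symb p) = Mlog_symb (symb_var k i * p).
Proof.
rewrite /Mlog_symb quantizeX.
exact/esym/(linearZZ (quotpi I) (opD k i) (quantize p)).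
Qed.

Definition Mlog_incl (r : R) : M := opM r *: Mlog_one f.

Lemma Mlog_inclE r : Mlog_incl r = Mlog_symb r%:S.
Proof.
rewrite /Mlog_incl /Mlog_symb quantizeC /Mlog_one -linearZ; congr (quotpi _ _).
exact: mulr1.
Qed.

Lemma Mlog_incl_is_linear : linear Mlog_incl.
Proof.
move=> c r s; rewrite /Mlog_incl raddfD scalerDl; congr (_ + _).
rewrite -[LHS]/(opM (c *: r) *: Mlog_one f).
rewrite (_ : opM (c *: r) = opC c * opM r) -?scalerA //.
by apply: weylE => g; rewrite weylME /= scalerAl.
Qed.
HB.instance Definition _ :=
  GRing.isLinear.Build k R M _ Mlog_incl Mlog_incl_is_linear.

Definition comparison_map (p : nat) (w : log_complex f p) : DR (Mlog f) p :=
  one_tensor f (numerator w).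

Lemma comparison_map_is_linear (p : nat) : linear (@comparison_map p).
Proof.
move=> a v w; rewrite /comparison_map numerator_is_linear //.
exact: (form_map_linear Mlog_incl).
Qed.
HB.instance Definition _ (p : nat) := GRing.isLinear.Build k (log_complex f p)
  (DR (Mlog f) p) _ (@comparison_map p) (@comparison_map_is_linear p).

Lemma comparison_mapE (p : nat) (w : log_complex f p) eta :
  mulf_form f (log_val w) = form_map inj eta ->
  comparison_map w = one_tensor f eta.
Proof. by rewrite /comparison_map => /numeratorE ->. Qed.

Lemma comparison_map0 (w : log_complex f 0) g :
  log_val w = inj g -> comparison_map w = Mlog_symb (f * g)%:S.
Proof.
move=> wE; rewrite (@comparison_mapE 0 w (f * g)); first exact: Mlog_inclE.
by rewrite wE /mulf_form /= inj_fracM.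
Qed.

Lemma comparison_map1 (w : log_complex f 1) a b :
  log_val w = divf_form f a b ->
  comparison_map w = (Mlog_symb a%:S, Mlog_symb b%:S).
Proof.
move=> wE; rewrite (@comparison_mapE 1 w (a, b)).
  by rewrite -!Mlog_inclE.
by rewrite wE /= /mulf_form /= /mul_by_f !mulf_divf.
Qed.

Lemma comparison_map2 (w : log_complex f 2) h :
  log_val w = inj h / inj f -> comparison_map w = Mlog_symb h%:S.
Proof.
move=> wE; rewrite (@comparison_mapE 2 w h); first exact: Mlog_inclE.
by rewrite wE /mulf_form /= /mul_by_f mulf_divf.
Qed.

Lemma log_val_diff (p : nat) (w : log_complex f p) :
  log_val (cdiff (log_complex f) p w) = dform (@ratderiv k) (log_val w).
Proof. by []. Qed.

Lemma dform_inj_frac g :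
  dform (@ratderiv k) (inj g : dRform (ratfun k) 0) =
  divf_form f (f * mderiv ix g) (f * mderiv iy g).
Proof.
have F0 : inj f != 0 by rewrite inj_frac_eq0.
by rewrite /divf_form !inj_fracM ![inj f * _]mulrC !mulfK //= !ratderiv_frac.
Qed.

Lemma comparison_map_diff (p : nat) (w : log_complex f p) :
  comparison_map (cdiff (log_complex f) p w) =
  cdiff (DR (Mlog f)) p (comparison_map w).
Proof.
case: p w => [|[|p]] w; last by apply/rowP => -[].
- have [g gE] := (log_form0P f0 f_sqf (log_val w)).1 (submodule_valP w).
  rewrite (@comparison_map1 _ (f * mderiv ix g) (f * mderiv iy g)); last first.
    by rewrite log_val_diff gE dform_inj_frac.
  (* As an operator, f g_x - d_1 f g is - g (f d_1 + f_x), a multiple of a generator; likewise for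
     y. *)
  rewrite (comparison_map0 gE) /= !actD_symb; congr (_, _);
    apply/Mlog_symb_eq; [exists (- (f * g)%:S), 0 | exists 0, (- (f * g)%:S)].
    exists (f * mderiv ix g)%:S; split; last by ring.
    rewrite -symb_constN -(symb_const0 k); apply/log_rel_const.
    by rewrite mderivN raddf0 mderivM; ring.
  exists (f * mderiv iy g)%:S; split; last by ring.
  rewrite -symb_constN -(symb_const0 k); apply/log_rel_const.
  by rewrite mderivN raddf0 mderivM; ring.
- have [a [b [c [wE e]]]] := (log_form1P f0 (log_val w)).1 (submodule_valP w).
  rewrite (@comparison_map2 _ (mderiv ix b - mderiv iy a - c)); last first.
    by rewrite log_val_diff wE (dform_divf_form f0 e).
  rewrite (comparison_map1 wE) /= !actD_symb -Mlog_symbB; apply/Mlog_symb_eq.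
  (* The corresponding operator is a d_2 - b d_1 - c, a generator because b f_x - a f_y = c f. *)
  exists (- b%:S), a%:S, (mderiv ix b - mderiv iy a - c)%:S; split; last by ring.
  rewrite -symb_constN; apply/log_rel_const; rewrite mderivN.
  by rewrite mulNr addrC -opprB e; ring.
Qed.

Definition comparison : cochain_hom (log_complex f) (DR (Mlog f)) :=
  CochainHom comparison_map_diff.

Lemma comparisonE (p : nat) (x : log_complex f p) :
  comparison p x = comparison_map x.
Proof. by []. Qed.

Lemma log_complex_ge3 (p : nat) (x y : log_complex f p.+3) : x = y.
Proof. by apply: val_inj; apply/rowP => -[]. Qed.

Lemma DR_ge3 (p : nat) (x y : DR (Mlog f) p.+3) : x = y.
Proof. by apply/rowP => -[]. Qed.

Lemma comparison_inj (p : nat) (x : log_complex f p) :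
  cdiff (log_complex f) p x = 0 ->
  is_coboundary (comparison p x) -> is_coboundary x.
Proof.
case: p x => [|[|[|p]]] x dx.
- have [g gE] := (log_form0P f0 f_sqf (log_val x)).1 (submodule_valP x).
  rewrite comparisonE (comparison_map0 gE) => /Mlog_symb_eq0 fg.
  have : dform (@ratderiv k) (inj g : dRform (ratfun k) 0) = 0.
    by rewrite -gE -log_val_diff dx.
  rewrite /= !ratderiv_frac => -[/eqP gx /eqP gy].
  rewrite !inj_frac_eq0 in gx gy; apply: val_inj.
  rewrite -[LHS]/(log_val x) gE (log_ideal_inj0 f0 f_sqf (eqP gx) (eqP gy) fg).
  exact: raddf0.
- have [a [b [c [xE e]]]] := (log_form1P f0 (log_val x)).1 (submodule_valP x).
  rewrite comparisonE (comparison_map1 xE) => -[y].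
  have [S ->] := Mlog_symb_surj y.
  rewrite /= !actD_symb => -[/Mlog_symb_eq aS /Mlog_symb_eq bS].
  have cE : mderiv ix b - mderiv iy a - c = 0.
    have : dform (@ratderiv k) (divf_form f a b) = 0.
      by rewrite -xE -log_val_diff dx.
    rewrite (dform_divf_form f0 e) => /eqP.
    by rewrite mulf_eq0 invr_eq0 !inj_frac_eq0 (negbTE f0) orbF => /eqP.
  have [|g [aE bE]] := log_ideal_inj1 f0 f_sqf _ aS bS.
    by rewrite e; congr (_ * _); apply/eqP; rewrite eq_sym -subr_eq0 cE.
  have gP : (inj g : dRform (ratfun k) 0) \in @log_form k f 0.
    by apply/(log_form0P f0 f_sqf); exists g.
  exists (Submodule gP); apply: val_inj.
  by rewrite -[LHS]/(log_val x) xE aE bE -dform_inj_frac.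
- have [h hE] := (log_form2P f0 (log_val x)).1 (submodule_valP x).
  rewrite comparisonE (comparison_map2 hE) => -[[y1 y2]] /=.
  have [P ->] := Mlog_symb_surj y1; have [Q ->] := Mlog_symb_surj y2.
  rewrite !actD_symb -Mlog_symbB => /Mlog_symb_eq/log_ideal_inj2.
  move=> [a [b [c [e hE']]]].
  have wP : divf_form f a b \in @log_form k f 1.
    by apply/(log_form1P f0); exists a, b, c.
  exists (Submodule wP); apply: val_inj.
  by rewrite -[LHS]/(log_val x) hE hE' -(dform_divf_form f0 e).
- by move=> _; exists 0; exact: log_complex_ge3.
Qed.

Lemma comparison_surj (p : nat) (y : DR (Mlog f) p) :
  cdiff (DR (Mlog f)) p y = 0 -> exists x : log_complex f p,
    cdiff (log_complex f) p x = 0 /\ is_coboundary (y - comparison p x).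
Proof.
case: p y => [|[|[|p]]] y.
- have [P ->] := Mlog_symb_surj y.
  move=> dP; have /Mlog_symb_eq0 PX : Mlog_symb (X1 * P) = 0.
    by rewrite -actD_symb; exact: (congr1 fst dP).
  have /Mlog_symb_eq0 PY : Mlog_symb (X2 * P) = 0.
    by rewrite -actD_symb; exact: (congr1 snd dP).
  have [c cP] := log_ideal_surj0 f0 f_sqf PX PY.
  have gP : (inj c%:MP : dRform (ratfun k) 0) \in @log_form k f 0.
    by apply/(log_form0P f0 f_sqf); exists c%:MP.
  exists (Submodule gP); split.
    apply: val_inj.
    rewrite -[LHS]/(dform (@ratderiv k) (inj c%:MP : dRform _ 0)).
    by rewrite /= !ratderiv_frac !mderivC raddf0.
  rewrite comparisonE (@comparison_map0 _ c%:MP) // -Mlog_symbB.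
  apply/Mlog_symb_eq0; by rewrite mulrC mul_mpolyC.
- case: y => y1 y2.
  have [P ->] := Mlog_symb_surj y1; have [Q ->] := Mlog_symb_surj y2.
  move=> dPQ; have /Mlog_symb_eq0/log_ideal_surj1[a [b [S [e aS bS]]]] :
    Mlog_symb (X1 * Q - X2 * P) = 0 by rewrite Mlog_symbB -!actD_symb; exact: dPQ.
  have wP : divf_form f a b \in @log_form k f 1.
    by apply/(log_form1P f0); exists a, b, (mderiv ix b - mderiv iy a).
  exists (Submodule wP); split.
    apply: val_inj; rewrite -[LHS]/(dform (@ratderiv k) (divf_form f a b)).
    by rewrite (dform_divf_form f0 e) subrr raddf0 mul0r.
  rewrite comparisonE (@comparison_map1 _ a b) //; exists (Mlog_symb S).
  have xE (p q r : T) :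
      log_ideal f (p - q - r) -> Mlog_symb p - Mlog_symb q = Mlog_symb r.
    by move=> h; rewrite -Mlog_symbB; apply/Mlog_symb_eq.
  by rewrite /= !actD_symb -(xE _ _ _ aS) -(xE _ _ _ bS).
- move=> _; have [P ->] := Mlog_symb_surj y.
  have [h [P' [Q PE]]] := log_ideal_surj2 P.
  have hP : (inj h / inj f : dRform (ratfun k) 2) \in @log_form k f 2.
    by apply/(log_form2P f0); exists h.
  exists (Submodule hP); split; first exact: log_complex_ge3.
  rewrite comparisonE (@comparison_map2 _ h) //; exists (Mlog_symb P', Mlog_symb Q).
  by rewrite /= !actD_symb -!Mlog_symbB PE addrC addKr.
- by move=> _; exists 0; split; [exact: log_complex_ge3 | exists 0; exact: DR_ge3].
Qed.

Lemma comparison_quasi_isomorphism : quasi_isomorphism comparison.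
Proof.
move=> p; apply: cohomology_map_bij; first exact: comparison_inj.
exact: comparison_surj.
Qed.

End Comparison.

Theorem theorem2p3 (K : realType) (f : {mpoly K[i][2]})
    (f_neq0 : f != 0) (f_reduced : square_free f) :
  exists phi : cochain_hom (log_complex f) (DR (Mlog f)),
    (forall (p : nat) (w : log_complex f p) (eta : dRform {mpoly K[i][2]} p),
        mulf_form f (log_val w) = form_map (@inj_frac K[i]) eta ->
        phi p w = one_tensor f eta)
    /\ quasi_isomorphism phi.
Proof.
exists (comparison f_neq0 f_reduced); split; last exact: comparison_quasi_isomorphism.
by move=> p w eta; exact: comparison_mapE.
Qed.
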